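(* For every integer $n \ge 0$, every $n$-subperfect ring is catenary, equidimensional, and has Krull dimension $n$.
   Context: All rings are commutative with identity. A ring is perfect if every flat module over it is projective (equivalently, it satisfies the descending chain condition on principal ideals). $Q(A)$ denotes the total quotient ring of a ring $A$, and $A$ is subperfect if $Q(A)$ is perfect. A sequence $x_1,\ldots,x_i$ in $A$ is a regular sequence if $(x_1,\ldots,x_i)A\neq A$ and each $x_j$ is a non-zero-divisor on $A/(x_1,\ldots,x_{j-1})A$; the empty sequence is considered a regular sequence. A ring $A$ is regularly subperfect if for each regular sequence $x_1,\ldots,x_i$ in $A$ (including the empty one) the ring $A/(x_1,\ldots,x_i)A$ is subperfect. For an integer $n\ge 0$, $A$ is $n$-subperfect if $A$ is regularly subperfect and every maximal regular sequence in $A$ has length $n$.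
   Formalization: A regular sequence counts as maximal if it cannot be prolonged inside some maximal ideal containing it (not merely in A), and infinite regular sequences are excluded; with maximality in A alone the claim fails, e.g. for k[y] × k with n = 1. *)

(* Defs.v *)
From HB Require Import structures.
From mathcomp Require Import all_boot all_order all_algebra.
From mathcomp Require Import generic_quotient ring_quotient ring.
From mathcomp Require Import boolp.

Set Implicit Arguments.
Unset Strict Implicit.
Unset Printing Implicit Defensive.

Import GRing.Theory.
Local Open Scope ring_scope.
Local Open Scope quotient_scope.

(* The library predicate [GRing.lreg a] says that multiplication by [a] is
   injective: in a commutative ring, [a] is a non-zero-divisor. *)

(* [{total_quotient A}] is the total quotient ring Q(A), made of the fractions
   n / d with d a non-zero-divisor; it follows the library's [{fraction R}],
   which is restricted to integral domains. *)
Module TotalQuotient.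
Section TotalQuotient.
Variable A : comNzRingType.

Record frac := Frac { numden :> A * A; fracP : `[< GRing.lreg numden.2 >] }.

HB.instance Definition _ := [isSub for numden].
HB.instance Definition _ := [Choice of frac by <:].

Implicit Types x y z : frac.

Lemma den_reg x : GRing.lreg x.2.
Proof. exact/asboolP/fracP. Qed.

Definition mkfrac (a b : A) (hb : GRing.lreg b) : frac :=
  @Frac (a, b) (asboolT hb).

Definition equivf x y : bool := x.1 * y.2 == y.1 * x.2.

Lemma equivf_refl : reflexive equivf.
Proof. by move=> x; rewrite /equivf. Qed.

Lemma equivf_sym : symmetric equivf.
Proof. by move=> x y; rewrite /equivf eq_sym. Qed.

Lemma equivf_trans : transitive equivf.
Proof.
move=> y x z /eqP xy /eqP yz; apply/eqP; apply: (den_reg (x := y)).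
by rewrite mulrA [y.2 * _]mulrC xy mulrAC yz; ring.
Qed.

Canonical equivf_equiv := EquivRel equivf equivf_refl equivf_sym equivf_trans.

Definition type := {eq_quot equivf}.

HB.instance Definition _ : EqQuotient _ equivf type := EqQuotient.on type.
HB.instance Definition _ := Choice.on type.

Definition addf x y : frac :=
  mkfrac (x.1 * y.2 + y.1 * x.2) (lregM (den_reg (x := x)) (den_reg (x := y))).
Definition oppf x : frac := mkfrac (- x.1) (den_reg (x := x)).
Definition mulf x y : frac :=
  mkfrac (x.1 * y.1) (lregM (den_reg (x := x)) (den_reg (x := y))).

Definition tofrac (a : A) : type := \pi_type (mkfrac a (@lreg1 A)).
Definition add := lift_op2 type addf.
Definition opp := lift_op1 type oppf.
Definition mul := lift_op2 type mulf.

Lemma pi_eq x y : x.1 * y.2 = y.1 * x.2 <-> \pi_type x = \pi_type y.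
Proof. by split=> [h|/eqmodP/eqP//]; apply/eqmodP/eqP. Qed.

Lemma reprE x :
  x.1 * (repr (\pi_type x)).2 = (repr (\pi_type x)).1 * x.2.
Proof. by apply/pi_eq; rewrite reprK. Qed.

Lemma pi_add x y : add (\pi_type x) (\pi_type y) = \pi_type (addf x y).
Proof.
unlock add; apply/pi_eq => /=; have := reprE x; have := reprE y.
move: (repr (\pi_type x)) (repr (\pi_type y)) => x' y' hy hx.
transitivity ((x'.1 * x.2) * (y.2 * y'.2) + (y'.1 * y.2) * (x.2 * x'.2)).
  by ring.
by rewrite -hx -hy; ring.
Qed.

Lemma pi_opp x : opp (\pi_type x) = \pi_type (oppf x).
Proof. by unlock opp; apply/pi_eq => /=; rewrite !mulNr reprE. Qed.

Lemma pi_mul x y : mul (\pi_type x) (\pi_type y) = \pi_type (mulf x y).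
Proof.
unlock mul; apply/pi_eq => /=; have := reprE x; have := reprE y.
move: (repr (\pi_type x)) (repr (\pi_type y)) => x' y' hy hx.
by rewrite mulrACA -hx -hy; ring.
Qed.

Lemma addA : associative add.
Proof.
elim/quotW=> x; elim/quotW=> y; elim/quotW=> z; rewrite !pi_add.
by apply/pi_eq => /=; ring.
Qed.

Lemma addC : commutative add.
Proof.
elim/quotW=> x; elim/quotW=> y; rewrite !pi_add.
by apply/pi_eq => /=; ring.
Qed.

Lemma add0 : left_id (tofrac 0) add.
Proof. by elim/quotW=> x; rewrite pi_add; apply/pi_eq => /=; ring. Qed.

Lemma addN : left_inverse (tofrac 0) opp add.
Proof. by elim/quotW=> x; rewrite pi_opp pi_add; apply/pi_eq => /=; ring. Qed.

HB.instance Definition _ := GRing.isZmodule.Build type addA addC add0 addN.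

Lemma mulA : associative mul.
Proof.
elim/quotW=> x; elim/quotW=> y; elim/quotW=> z; rewrite !pi_mul.
by apply/pi_eq => /=; ring.
Qed.

Lemma mulC : commutative mul.
Proof.
elim/quotW=> x; elim/quotW=> y; rewrite !pi_mul.
by apply/pi_eq => /=; ring.
Qed.

Lemma mul1 : left_id (tofrac 1) mul.
Proof. by elim/quotW=> x; rewrite pi_mul; apply/pi_eq => /=; ring. Qed.

Lemma mulDl : left_distributive mul add.
Proof.
elim/quotW=> x; elim/quotW=> y; elim/quotW=> z; rewrite !(pi_add, pi_mul).
by apply/pi_eq => /=; ring.
Qed.

Lemma nonzero1 : tofrac 1 != tofrac 0.
Proof.
by apply/eqP => /pi_eq /= /eqP; rewrite !mulr1 oner_eq0.
Qed.

HB.instance Definition _ :=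
  GRing.Zmodule_isComNzRing.Build type mulA mulC mul1 mulDl nonzero1.

End TotalQuotient.
End TotalQuotient.
HB.export TotalQuotient.

Notation "{ 'total_quotient' A }" := (TotalQuotient.type A)
  (format "{ 'total_quotient'  A }") : type_scope.

(* The tensor product of N and M over R is a pair (T, tau) with tau universal
   among the bilinear maps out of N x M. It is unique up to isomorphism, and
   flatness does not depend on the model. *)
Definition is_bilinear (R : comNzRingType) (N M P : lmodType R)
    (b : N -> M -> P) : Prop :=
  (forall x, linear (b x)) /\ (forall y, linear (fun x => b x y)).

Definition is_tensor (R : comNzRingType) (N M T : lmodType R)
    (tau : N -> M -> T) : Prop :=
  is_bilinear tau /\
  forall (P : lmodType R) (b : N -> M -> P), is_bilinear b ->
    exists2 h : {linear T -> P}, (forall x y, h (tau x y) = b x y) &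
      forall h' : {linear T -> P}, (forall x y, h' (tau x y) = b x y) ->
        h' =1 h.

(* M is flat: - (x) M preserves injectivity; here g is f (x) id_M. *)
Definition flat (R : comNzRingType) (M : lmodType R) : Prop :=
  forall (N N' T T' : lmodType R) (tau : N -> M -> T) (tau' : N' -> M -> T')
      (f : {linear N -> N'}) (g : {linear T -> T'}),
    is_tensor tau -> is_tensor tau' ->
    (forall x y, g (tau x y) = tau' (f x) y) ->
    injective f -> injective g.

Definition projective (R : comNzRingType) (M : lmodType R) : Prop :=
  forall (N N' : lmodType R) (p : {linear N -> N'}) (f : {linear M -> N'}),
    (forall y, exists x, p x = y) ->
    exists h : {linear M -> N}, forall m, p (h m) = f m.

Definition perfect (R : comNzRingType) : Prop :=
  forall M : lmodType R, flat M -> projective M.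

Definition subperfect (A : comNzRingType) : Prop := perfect {total_quotient A}.

(* The library's [idealr_closed] means "is a proper ideal". *)
Definition ideal_of (A : comNzRingType) (I : A -> bool)
    (hI : idealr_closed I) : idealr A :=
  HB.pack I (GRing.isZmodClosed.Build A I (idealr_closedB hI))
            (isProperIdeal.Build A I (idealr_closed_nontrivial hI)).

Definition quot_ring (A : comNzRingType) (I : A -> bool)
    (hI : idealr_closed I) : comNzRingType := {ideal_quot (ideal_of hI)}.

Definition gen_ideal (A : comNzRingType) (s : seq A) : A -> bool :=
  fun a => `[< exists c : 'I_(size s) -> A, a = \sum_i c i * s`_i >].

Lemma gen_ideal_closed (A : comNzRingType) (s : seq A) :
  1 \notin gen_ideal s -> idealr_closed (gen_ideal s).
Proof.
move=> s1; split=> // [|a u v /asboolP[c ->] /asboolP[d ->]]; apply/asboolP.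
  by exists (fun=> 0); rewrite big1 // => i _; rewrite mul0r.
exists (fun i => a * c i + d i); rewrite mulr_sumr -big_split /=.
by apply: eq_bigr => i _; rewrite mulrDl mulrA.
Qed.

(* The second condition unfolds "s`_j is a non-zero-divisor on
   A/(s`_0, ..., s`_(j-1))A". As A is nonzero, [::] is regular. *)
Definition regular_seq (A : comNzRingType) (s : seq A) : Prop :=
  1 \notin gen_ideal s /\
  forall j, (j < size s)%N -> forall a,
    s`_j * a \in gen_ideal (take j s) -> a \in gen_ideal (take j s).

Definition regularly_subperfect (A : comNzRingType) : Prop :=
  forall (s : seq A) (hs : regular_seq s),
    subperfect (quot_ring (gen_ideal_closed hs.1)).

Definition maximal_ideal (A : comNzRingType) (M : A -> bool) : Prop :=
  idealr_closed M /\
  forall J : A -> bool, idealr_closed J -> {subset M <= J} -> {subset J <= M}.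

(* A regular sequence generates a proper ideal, hence lies in a maximal ideal;
   it is called maximal when, inside some maximal ideal M containing it, it
   cannot be prolonged to a longer regular sequence (the classical notion of
   a maximal regular sequence in M). Over a local ring this just says that it
   cannot be prolonged in A. For A = k[y] x k, where (y, 1) is regular, the
   empty sequence is maximal in M = k[y] x 0. *)
Definition maximal_regular_seq (A : comNzRingType) (s : seq A) : Prop :=
  regular_seq s /\
  exists M : A -> bool,
    [/\ maximal_ideal M, {subset s <= M} &
        forall x, x \in M -> ~ regular_seq (rcons s x)].

(* An infinite sequence is regular if its initial segments are; it cannot be
   prolonged, so it would be a maximal regular sequence of infinite length.
   Without its exclusion k[x_1, x_2, ...], which has no finite maximal regular
   sequence, would be n-subperfect for every n. *)
Definition n_subperfect (n : nat) (A : comNzRingType) : Prop :=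
  [/\ regularly_subperfect A,
      forall s : seq A, maximal_regular_seq s -> size s = n &
      ~ exists x : nat -> A, forall i, regular_seq (mkseq x i)].

Definition prime_ideal (A : comNzRingType) (P : A -> bool) : Prop :=
  idealr_closed P /\ prime_idealr_closed P.

Definition strict_sub (A : Type) (P Q : A -> bool) : Prop :=
  {subset P <= Q} /\ exists2 a, a \in Q & a \notin P.

(* c 0 < c 1 < ... < c m; the values of c beyond m are irrelevant. *)
Definition prime_chain (A : comNzRingType) (m : nat) (c : nat -> A -> bool) :
    Prop :=
  (forall i, (i <= m)%N -> prime_ideal (c i)) /\
  (forall i, (i < m)%N -> strict_sub (c i) (c i.+1)).

Definition chain_between (A : comNzRingType) (P Q : A -> bool) (m : nat)
    (c : nat -> A -> bool) : Prop :=
  [/\ prime_chain m c, c 0%N =i P & c m =i Q].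

Definition saturated_chain (A : comNzRingType) (m : nat)
    (c : nat -> A -> bool) : Prop :=
  prime_chain m c /\
  forall i, (i < m)%N -> ~ exists P : A -> bool,
    [/\ prime_ideal P, strict_sub (c i) P & strict_sub P (c i.+1)].

(* Between primes P <= Q, chains have bounded length and all saturated ones
   have the same length. *)
Definition catenary (A : comNzRingType) : Prop :=
  forall P Q : A -> bool, prime_ideal P -> prime_ideal Q -> {subset P <= Q} ->
  (exists b, forall m c, chain_between P Q m c -> (m <= b)%N) /\
  (forall m m' c c', chain_between P Q m c -> saturated_chain m c ->
     chain_between P Q m' c' -> saturated_chain m' c' -> m = m').

(* Krull dimension, as a relation; [None] stands for infinity. *)
Definition has_krull_dim (A : comNzRingType) (d : option nat) : Prop :=
  match d with
  | Some n => (exists c : nat -> A -> bool, prime_chain n c) /\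
              (forall m (c : nat -> A -> bool), prime_chain m c -> (m <= n)%N)
  | None => forall m, exists c : nat -> A -> bool, prime_chain m c
  end.

Definition minimal_prime (A : comNzRingType) (P : A -> bool) : Prop :=
  prime_ideal P /\
  forall Q : A -> bool, prime_ideal Q -> {subset Q <= P} -> {subset P <= Q}.

(* All the rings A/P, with P a minimal prime, have the same dimension. *)
Definition equidimensional (A : comNzRingType) : Prop :=
  exists d : option nat, forall (P : A -> bool) (hP : minimal_prime P),
    has_krull_dim (quot_ring hP.1.1) d.

(* Main.v *)
From HB Require Import structures.
Require Import Defs.
From mathcomp Require Import all_boot all_algebra.
From mathcomp Require Import generic_quotient ring_quotient ring zify.
From mathcomp Require Import boolp classical_sets.

Set Implicit Arguments.
Unset Strict Implicit.
Unset Printing Implicit Defensive.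

Import GRing.Theory.
Local Open Scope ring_scope.
Local Open Scope quotient_scope.

(** Why the theorem holds.

    Call depth of a prime [Q] the length of a maximal regular sequence in [Q],
    that is, of a regular sequence [s] in [Q] such that all the elements of [Q]
    are zero-divisors modulo [(s)]. The theorem follows from three facts:
    - the depth does not depend on the sequence ([regular_length_unique]);
    - the depth increases strictly along strict inclusions of primes
      ([depth_strict]), and by exactly 1 from a prime to an adjacent one
      ([depth_adjacent]);
    - the depth is [n] at the maximal ideals, by hypothesis, and 0 at the
      minimal primes ([minimal_depth0]).
    A saturated chain from [P] to [Q] then has length depth Q - depth P, whence
    catenarity, and a saturated chain from a minimal prime to a maximal ideal
    has length [n], whence the two dimension statements.

    All that is used of perfect rings is a theorem of Bass: their principal
    ideals satisfy the descending chain condition ([perfect_dcc]). It comes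
    from the direct limit of copies of [R] along the multiplications by
    [r 0], [r 1], ...: this module is flat, hence projective, and a splitting
    of its presentation by a free module forces the chain generated by the
    products of the [r i] to stop.

    Let [I] be generated by a regular sequence. The chain condition in the
    total quotient ring of A/I has these consequences, stated in A with
    denominators cleared. The zero-divisors modulo [I] are the union of
    finitely many primes ([finite_primes]), pairwise incomparable
    ([degenerate_incomparable]); hence, by prime avoidance, an ideal that
    contains a regular element modulo each of several such [I] contains one
    element that serves for all. A prime [P] of zero-divisors modulo [I] can be
    isolated from the others ([isolating_pair]) and is contained in the
    annihilator of a nonzero class ([degenerate_annihilator]).

    Uniqueness of the length is an exchange argument: a common element
    [z] replaces the last terms of two maximal sequences
    ([degenerate_exchange]), it is moved to the front ([move_front]), and one
    argues by induction modulo [z]. The step from [P] to an adjacent [Q]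
    replaces the principal ideal theorem, which is false without noetherian
    hypotheses: the isolating pair of [P] provides an element [w] of [Q],
    regular modulo [I], for which [Q] is a minimal prime divisor of a conductor
    into [(I, w)] ([adjacent_degenerate]). *)

(** * Telescopes: direct limits along multiplications *)

Definition eventually (P : nat -> Prop) : Prop :=
  exists m, forall i, (m <= i)%N -> P i.

Lemma eventuallyT (P : nat -> Prop) : (forall i, P i) -> eventually P.
Proof. by move=> h; exists 0%N. Qed.

Lemma eventually_and (P Q : nat -> Prop) :
  eventually P -> eventually Q -> eventually (fun i => P i /\ Q i).
Proof.
move=> [m hm] [k hk]; exists (maxn m k) => i; rewrite geq_max => /andP[mi ki].
by split; [exact: hm | exact: hk].
Qed.

Lemma eventually_imp (P Q : nat -> Prop) :
  eventually P -> (forall i, P i -> Q i) -> eventually Q.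
Proof. by move=> [m hm] PQ; exists m => i /hm /PQ. Qed.

(** The direct limit of N -> N -> N -> ..., whose [i]-th map is multiplication
    by [r i]. The pair [(k, n)] stands for the class of the element [n] of the
    [k]-th copy. *)
Module Telescope.
Section Telescope.
Variables (R : comNzRingType) (r : nat -> R) (N : lmodType R).

Definition pair : Type := (nat * N)%type.
HB.instance Definition _ := Choice.on pair.

Implicit Types x y : pair.

(** The transition maps from stage [x.1] to stage [i], applied to [x.2]; for
    [i < x.1] the product is empty and the value has no meaning, which is
    harmless as values are compared for large [i] only. *)
Definition value x (i : nat) : N := (\prod_(x.1 <= j < i) r j) *: x.2.

Definition equiv x y : bool :=
  `[< eventually (fun i => value x i = value y i) >].

Lemma equiv_refl : reflexive equiv.
Proof. by move=> x; apply/asboolP/eventuallyT. Qed.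

Lemma equiv_sym : symmetric equiv.
Proof.
by move=> x y; apply/asboolP/asboolP => /eventually_imp; apply=> i ->.
Qed.

Lemma equiv_trans : transitive equiv.
Proof.
move=> y x z /asboolP xy /asboolP yz; apply/asboolP.
by apply: eventually_imp (eventually_and xy yz) _ => i [-> ->].
Qed.

Canonical equiv_equiv := EquivRel equiv equiv_refl equiv_sym equiv_trans.

Definition type := {eq_quot equiv}.
HB.instance Definition _ : EqQuotient _ equiv type := EqQuotient.on type.
HB.instance Definition _ := Choice.on type.

Definition at_stage (k : nat) (n : N) : type := \pi_type (k, n).

Lemma at_stageP k n l p :
  at_stage k n = at_stage l p <->
  eventually (fun i => value (k, n) i = value (l, p) i).
Proof.
by split=> [/eqmodP/asboolP //|h]; apply/eqmodP/asboolP.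
Qed.

Lemma at_stage_repr (u : type) : u = at_stage (repr u).1 (repr u).2.
Proof. by rewrite /at_stage -surjective_pairing reprK. Qed.

Lemma value_shift k n m i : (k <= m)%N -> (m <= i)%N ->
  value (m, (\prod_(k <= j < m) r j) *: n) i = value (k, n) i.
Proof.
by move=> km mi; rewrite /value scalerA mulrC /= -big_cat_nat.
Qed.

Lemma at_stage_shift k n m : (k <= m)%N ->
  at_stage k n = at_stage m ((\prod_(k <= j < m) r j) *: n).
Proof.
by move=> km; apply/at_stageP; exists m => i mi; rewrite value_shift.
Qed.

(* Sums are computed after moving both terms to a common stage. *)
Definition add (u v : type) : type :=
  let m := maxn (repr u).1 (repr v).1 in
  at_stage m (value (repr u) m + value (repr v) m).
Definition opp (u : type) : type := at_stage (repr u).1 (- (repr u).2).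
Definition scale (a : R) (u : type) : type :=
  at_stage (repr u).1 (a *: (repr u).2).
Definition zero : type := at_stage 0 0.

Lemma valueD k n n' i : value (k, n + n') i = value (k, n) i + value (k, n') i.
Proof. by rewrite /value scalerDr. Qed.

Lemma reprE k n :
  eventually (fun i => value (repr (at_stage k n)) i = value (k, n) i).
Proof.
have := at_stage_repr (at_stage k n) => /esym /at_stageP.
by rewrite -surjective_pairing.
Qed.

Lemma add_same k n n' :
  add (at_stage k n) (at_stage k n') = at_stage k (n + n').
Proof.
apply/at_stageP; set u := repr (at_stage k n); set v := repr (at_stage k n').
have [m hm] := eventually_and (reprE k n) (reprE k n').
exists (maxn m (maxn u.1 v.1)) => i; rewrite !geq_max => /and3P[mi ui vi].
have [un vn] := hm i mi; rewrite !valueD -un -vn.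
congr (_ + _).
  rewrite {2}[u]surjective_pairing /value /= scalerA mulrC.
  by rewrite -big_cat_nat ?leq_maxl ?geq_max ?ui ?vi.
rewrite {2}[v]surjective_pairing /value /= scalerA mulrC.
by rewrite -big_cat_nat ?leq_maxr ?geq_max ?ui ?vi.
Qed.

Lemma opp_at k n : opp (at_stage k n) = at_stage k (- n).
Proof.
apply/at_stageP; apply: eventually_imp (reprE k n) _ => i.
by rewrite /value /= !scalerN => ->.
Qed.

Lemma scale_at a k n : scale a (at_stage k n) = at_stage k (a *: n).
Proof.
apply/at_stageP; apply: eventually_imp (reprE k n) _ => i.
by rewrite /value /= !scalerA ![_ * a]mulrC -!scalerA => ->.
Qed.

Lemma zero_at k : zero = at_stage k 0.
Proof. by apply/at_stageP/eventuallyT => i; rewrite /value !scaler0. Qed.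

Lemma at_later_stage (u : type) k :
  exists2 m, (k <= m)%N & exists n, u = at_stage m n.
Proof.
exists (maxn (repr u).1 k); first exact: leq_maxr.
by eexists; rewrite {1}[u]at_stage_repr; apply: at_stage_shift; exact: leq_maxl.
Qed.

Lemma common_stage2 (u v : type) :
  exists m n n', u = at_stage m n /\ v = at_stage m n'.
Proof.
have [m le_m [n' ->]] := at_later_stage v (repr u).1.
by rewrite [u]at_stage_repr (at_stage_shift _ le_m); do 3 eexists.
Qed.

Lemma common_stage3 (u v w : type) :
  exists m n n' n'', [/\ u = at_stage m n,
    v = at_stage m n' & w = at_stage m n''].
Proof.
have [k [n [n' [-> ->]]]] := common_stage2 u v.
have [m le_m [n'' ->]] := at_later_stage w k.
by rewrite !(at_stage_shift _ le_m); do 4 eexists.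
Qed.

Lemma addA : associative add.
Proof.
move=> u v w; have [m [n [n' [n'' [-> -> ->]]]]] := common_stage3 u v w.
by rewrite !add_same addrA.
Qed.

Lemma addC : commutative add.
Proof.
move=> u v; have [m [n [n' [-> ->]]]] := common_stage2 u v.
by rewrite !add_same addrC.
Qed.

Lemma add0 : left_id zero add.
Proof.
by move=> u; rewrite [u]at_stage_repr (zero_at (repr u).1) add_same add0r.
Qed.

Lemma addN : left_inverse zero opp add.
Proof.
move=> u; rewrite [u]at_stage_repr opp_at add_same addNr.
by rewrite -zero_at.
Qed.

HB.instance Definition _ := GRing.isZmodule.Build type addA addC add0 addN.

Lemma at_stageD k n n' :
  at_stage k (n + n') = at_stage k n + at_stage k n'.
Proof. by rewrite -add_same. Qed.

Lemma scaleA a b (u : type) : scale a (scale b u) = scale (a * b) u.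
Proof. by rewrite [u]at_stage_repr !scale_at scalerA. Qed.

Lemma scale1 : left_id 1 scale.
Proof. by move=> u; rewrite [u]at_stage_repr scale_at scale1r. Qed.

Lemma scaleDr : right_distributive scale +%R.
Proof.
move=> a u v; have [m [n [n' [-> ->]]]] := common_stage2 u v.
by rewrite -at_stageD !scale_at -at_stageD scalerDr.
Qed.

Lemma scaleDl u : {morph scale^~ u : a b / a + b}.
Proof.
move=> a b; rewrite [u]at_stage_repr.
by rewrite !scale_at -at_stageD scalerDl.
Qed.

HB.instance Definition _ :=
  GRing.Zmodule_isLmodule.Build R type scaleA scale1 scaleDr scaleDl.

Lemma at_stageZ k a n : at_stage k (a *: n) = a *: at_stage k n.
Proof. by rewrite -scale_at. Qed.

End Telescope.
End Telescope.
HB.export Telescope.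

Notation telescope := Telescope.type.

Arguments Telescope.at_stage {R r N}.

Notation telescope_gen r k := (@Telescope.at_stage _ r _^o k 1).

(** * Telescopes of the regular module are flat *)

Section TelescopeFlat.
Variables (R : comNzRingType) (r : nat -> R).

Local Notation F := (telescope r R^o).
Local Notation gen k := (telescope_gen r k).

Lemma at_stage_mul1 k (a : R) :
  Telescope.at_stage k (a : R^o) = a *: gen k.
Proof. by rewrite -Telescope.at_stageZ; congr Telescope.at_stage;
  rewrite [RHS]mulr1. Qed.

Lemma at_stage1_shift k m : (k <= m)%N ->
  gen k = (\prod_(k <= j < m) r j) *: gen m.
Proof.
by move=> km; rewrite (Telescope.at_stage_shift _ _ km) -Telescope.at_stageZ.
Qed.

(** The bilinear map that makes the telescope of [N] a tensor product of [N] and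
    the telescope of the regular module: tensor products commute with direct
    limits. *)
Definition tensor_telescope (N : lmodType R) (n : N) (u : F) : telescope r N :=
  Telescope.at_stage (repr u).1 (((repr u).2 : R) *: n).

Lemma tensor_telescopeE (N : lmodType R) (n : N) k (a : R) :
  tensor_telescope n (Telescope.at_stage k (a : R^o)) =
  Telescope.at_stage k (a *: n).
Proof.
apply/Telescope.at_stageP.
have := Telescope.reprE r k (a : R^o) => /eventually_imp; apply=> i.
rewrite /Telescope.value /= => /(congr1 (fun b : R => b *: n)).
by rewrite ![_ *: (_ : R^o)]/(_ * _) !scalerA.
Qed.

Lemma tensor_telescope_bilinear (N : lmodType R) :
  is_bilinear (@tensor_telescope N).
Proof.
split=> [n a u v|u a n n'].
  have [m [b [c [-> ->]]]] := Telescope.common_stage2 u v.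
  rewrite -Telescope.at_stageZ -Telescope.at_stageD !tensor_telescopeE.
  by rewrite scalerDl -scalerA Telescope.at_stageD Telescope.at_stageZ.
rewrite [u]Telescope.at_stage_repr !tensor_telescopeE scalerDr.
by rewrite Telescope.at_stageD scalerA mulrC -scalerA Telescope.at_stageZ.
Qed.

Section Tensor.
Variables (N T : lmodType R) (tau : N -> F -> T).
Hypothesis tauT : is_tensor tau.

Definition of_telescope (w : telescope r N) : T :=
  tau (repr w).2 (gen (repr w).1).

Lemma tensorZl a n u : tau (a *: n) u = a *: tau n u.
Proof. exact: (GRing.scalable_linear (tauT.1.2 u)). Qed.

Lemma tensorZr a n u : tau n (a *: u) = a *: tau n u.
Proof. exact: (GRing.scalable_linear (tauT.1.1 n)). Qed.

Lemma of_telescopeE k n :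
  of_telescope (Telescope.at_stage k n) = tau n (gen k).
Proof.
rewrite /of_telescope; set w := repr _.
have [m hm] := Telescope.reprE r k n; rewrite -/w in hm.
pose i := maxn m (maxn k w.1).
have [mi ki wi] : [/\ (m <= i)%N, (k <= i)%N & (w.1 <= i)%N].
  by rewrite /i; split; lia.
rewrite (at_stage1_shift wi) (at_stage1_shift ki) !tensorZr -!tensorZl.
by have := hm i mi; rewrite /Telescope.value /= => ->.
Qed.

Lemma of_telescope_linear : linear of_telescope.
Proof.
move=> a u v; have [m [n [n' [-> ->]]]] := Telescope.common_stage2 u v.
rewrite -Telescope.at_stageZ -Telescope.at_stageD !of_telescopeE.
exact: tauT.1.2.
Qed.

HB.instance Definition _ :=
  GRing.isLinear.Build R (telescope r N) T _ of_telescope of_telescope_linear.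

(** A tensor product [T] embeds in the telescope of [N]: the composite
    T -> telescope r N -> T fixes the pure tensors, so it is the identity by
    the uniqueness part of the universal property. *)
Lemma to_telescope : exists h : {linear T -> telescope r N},
  (forall n k (a : R), h (tau n (Telescope.at_stage k (a : R^o))) =
                 Telescope.at_stage k (a *: n)) /\
  cancel h of_telescope.
Proof.
have [h hE _] := tauT.2 _ _ (@tensor_telescope_bilinear N).
exists h; split=> [n k a|]; first by rewrite hE tensor_telescopeE.
have [id' _ uniq] := tauT.2 _ _ tauT.1.
have := uniq (of_telescope \o h : {linear T -> T}).
have := uniq (idfun : {linear T -> T}) => id1 kh t.
have /= -> := kh _ t; last first.
  move=> n u; rewrite /= hE [u]Telescope.at_stage_repr tensor_telescopeE.
  by rewrite of_telescopeE tensorZl -tensorZr -at_stage_mul1.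
by have /= <- := id1 _ t.
Qed.

Lemma tensor_at_stage t : exists n k, t = tau n (gen k).
Proof.
have [h [_ hK]] := to_telescope.
by rewrite -(hK t) [h t]Telescope.at_stage_repr of_telescopeE; do 2 eexists.
Qed.

Lemma tensor_at_stage_eq0 n k : tau n (gen k) = 0 ->
  exists2 m, (k <= m)%N & (\prod_(k <= j < m) r j) *: n = 0.
Proof.
have [h [hE _]] := to_telescope => /(congr1 h).
rewrite hE raddf0 scale1r [0](Telescope.zero_at r N k).
move=> /Telescope.at_stageP[m hm]; exists (maxn m k); first exact: leq_maxr.
have := hm (maxn m k); rewrite leq_maxl /Telescope.value /= scaler0.
exact.
Qed.

End Tensor.

(** A tensor is a pure tensor of some [n] with a generator, and it vanishes only
    if a finite product of the [r j] kills [n]; the injectivity of [f] carries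
    this condition back from [f n] to [n]. *)
Lemma telescope_flat : flat (telescope r R^o).
Proof.
move=> N N' T T' tau tau' f g tauT tauT' gE f_inj.
apply/raddf_inj => t; have [n [k ->]] := tensor_at_stage tauT t.
rewrite -[X in X = 0]/(g _) gE => /(tensor_at_stage_eq0 tauT')[m km].
rewrite -linearZ /= -(linear0 f) => /f_inj pn0.
by rewrite (at_stage1_shift km)
  (tensorZr tauT) -(tensorZl tauT) pn0 -(scale0r 0) (tensorZl tauT) scale0r.
Qed.

End TelescopeFlat.

(** * The descending chain condition *)

(** Bass: project the free module {poly R} onto the telescope by sending 'X^i to
    the [i]-th generator, and let [h] be a section. The polynomial
    [f 0] := h (generator 0) is divisible by every product of the [r i], and
    its image is generator 0. As [f 0] has finitely many coefficients, this
    image can be computed at a finite stage [m], where the equality says that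
    the product of the first [m] terms is a combination of the coefficients of
    [f 0], hence a multiple of the product of the first [m.+1] terms. *)
Lemma perfect_dcc (R : comNzRingType) (r : nat -> R) : perfect R ->
  exists m c, \prod_(i < m) r i = c * \prod_(i < m.+1) r i.
Proof.
move=> perfR; have projF := perfR _ (telescope_flat (r := r)).
pose p (q : {poly R}) : telescope r R^o :=
  \sum_(i < size q) q`_i *: telescope_gen r i.
have pE n (q : {poly R}) : (size q <= n)%N ->
    p q = \sum_(i < n) q`_i *: telescope_gen r i.
  move=> qn; rewrite /p (big_ord_widen n (fun i =>
    q`_i *: telescope_gen r i) qn).
  rewrite big_mkcond /=; apply: eq_bigr => i _; case: ltnP => // qi.
  by rewrite nth_default // scale0r.
have p_lin : linear p.
  move=> a u v; pose n := maxn (size (a *: u + v)) (maxn (size u) (size v)).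
  rewrite !(pE n); try by rewrite /n; lia.
  rewrite scaler_sumr -big_split /=; apply: eq_bigr => i _.
  by rewrite coefD coefZ scalerDl scalerA.
pose pL : {linear {poly R} -> telescope r R^o} :=
  HB.pack p (GRing.isLinear.Build R {poly R} (telescope r R^o) _ p p_lin).
have p_surj u : exists q, pL q = u.
  exists (((repr u).2 : R) *: 'X^((repr u).1));
    rewrite linearZ /= (pE (repr u).1.+1); last by rewrite size_polyXn.
  rewrite big_ord_recr /= big1 ?add0r.
    by rewrite coefXn eqxx scale1r -at_stage_mul1 -Telescope.at_stage_repr.
  by move=> i _; rewrite coefXn ltn_eqF ?scale0r.
have [h hK] := projF _ _ pL (idfun : {linear (telescope r R^o) ->
  telescope r R^o}) p_surj.
pose f k := h (telescope_gen r k).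
have f_shift k : f 0%N = (\prod_(i < k) r i) *: f k.
  by rewrite /f (at_stage1_shift r (leq0n k)) linearZ /= big_mkord.
pose K := size (f 0%N).
have : telescope_gen r 0 = Telescope.at_stage K
    (\sum_(i < K) (f 0%N)`_i * \prod_(i <= j < K) r j : R^o).
  rewrite -[LHS]/(idfun _) -hK -/(f 0%N) /= (pE K) //.
  rewrite [RHS]at_stage_mul1 scaler_suml; apply: eq_bigr => i _.
  by rewrite -scalerA -at_stage1_shift // ltnW.
move=> /Telescope.at_stageP[m0 hm]; pose m := maxn m0 K.
have Km : (K <= m)%N := leq_maxr _ _.
have := hm m (leq_maxl _ _); rewrite /Telescope.value /= => E.
have {}E : \prod_(i < m) r i = \prod_(K <= j < m) r j *
    (\sum_(i < K) (f 0%N)`_i * \prod_(i <= j < K) r j).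
  by move: E; rewrite [LHS]mulr1 big_mkord.
exists m, (\prod_(K <= j < m) r j *
    (\sum_(i < K) (f m.+1)`_i * \prod_(i <= j < K) r j)).
rewrite {1}E -mulrA; congr (_ * _); rewrite mulr_suml; apply: eq_bigr => i _.
by rewrite (f_shift m.+1) coefZ; ring.
Qed.

Definition nzd_mod (A : comNzRingType) (I : A -> bool) (z : A) : Prop :=
  forall a, z * a \in I -> a \in I.

(** The descending chain condition on the principal ideals of the total quotient
    ring of the ring modulo [I], for the chains of the products of the [r i];
    [c] and [d] are the numerator and the denominator of the factor that
    exhibits the equality of two consecutive ideals. *)
Definition dcc_mod (A : comNzRingType) (I : A -> bool) : Prop :=
  forall r : nat -> A, exists m c d,
    nzd_mod I d /\ d * \prod_(i < m) r i - c * \prod_(i < m.+1) r i \in I.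

Lemma tofracM (B : comNzRingType) :
  {morph @TotalQuotient.tofrac B : a b / a * b}.
Proof.
by move=> a b; rewrite [RHS]TotalQuotient.pi_mul;
  apply/TotalQuotient.pi_eq => /=; ring.
Qed.

Lemma subperfect_dcc (B : comNzRingType) (r : nat -> B) : subperfect B ->
  exists m c d, GRing.lreg d /\ d * \prod_(i < m) r i =
    c * \prod_(i < m.+1) r i.
Proof.
move=> /(perfect_dcc (fun i => TotalQuotient.tofrac (r i)))[m [c]].
rewrite -!(big_morph _ (@tofracM B) (erefl _)).
elim/quotW: c => c; rewrite [RHS]TotalQuotient.pi_mul =>
  /TotalQuotient.pi_eq /=.
rewrite !mulr1 => E; exists m, c.1, c.2; split;
  first exact: TotalQuotient.den_reg.
by rewrite mulrC E.
Qed.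

Lemma quot_dcc (A : comNzRingType) (I : A -> bool) (hI : idealr_closed I) :
  subperfect (quot_ring hI) -> dcc_mod I.
Proof.
move=> sub r; pose pr : A -> quot_ring hI := \pi_{ideal_quot (ideal_of hI)}.
have prE a b : pr a = pr b <-> a - b \in I.
  rewrite -[a - b \in I]/(a - b \in ideal_of hI) Quotient.idealrBE.
  by split=> [/eqP|/eqP].
have prM : {morph pr : a b / a * b}.
  by move=> a b; rewrite /pr -rmorphM.
have [m [c [d [d_reg]]]] := subperfect_dcc (pr \o r) sub.
have pr1 : pr 1 = 1 by rewrite /pr rmorph1.
rewrite -!(big_morph _ prM pr1).
elim/quotW: c => c; elim/quotW: d d_reg => d d_reg; rewrite -/(pr c) -/(pr d).
rewrite -!prM => /prE E; exists m, c, d; split=> // a da.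
have pr0 x : (pr x = pr 0) <-> x \in I by rewrite prE subr0.
apply/pr0; apply: d_reg; rewrite -!prM mulr0; exact/pr0.
Qed.

(** * Primes of zero-divisors under the chain condition *)

Section Ideals.
Variable A : comNzRingType.
Implicit Types (I J K P Q X : A -> bool) (a b c d g p q v w x z : A).
Implicit Types L : seq (A -> bool).

Lemma ideal0 I : idealr_closed I -> 0 \in I. Proof. by case. Qed.

Lemma ideal1 I : idealr_closed I -> 1 \notin I. Proof. by case. Qed.

Lemma idealD I a b : idealr_closed I -> a \in I -> b \in I -> a + b \in I.
Proof. by move=> [_ _ hI] Ia Ib; rewrite -[a]mul1r; apply: hI. Qed.

Lemma ideal_mull I a b : idealr_closed I -> b \in I -> a * b \in I.
Proof. by move=> [I0 _ hI] Ib; rewrite -[_ * _]addr0; apply: hI. Qed.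

Lemma ideal_mulr I a b : idealr_closed I -> a \in I -> a * b \in I.
Proof. by move=> hI Ia; rewrite mulrC; apply: ideal_mull. Qed.

Lemma idealB I a b : idealr_closed I -> a \in I -> b \in I -> a - b \in I.
Proof.
by move=> hI Ia Ib; rewrite -mulN1r; apply: idealD => //; apply: ideal_mull.
Qed.

Lemma ideal_subr I a b : idealr_closed I -> a - b \in I -> b \in I -> a \in I.
Proof. by move=> hI Iab Ib; rewrite -[a](subrK b); apply: idealD. Qed.

Lemma primeM P a b : prime_ideal P -> a \notin P -> b \notin P ->
  a * b \notin P.
Proof. by move=> [_ hP] Pa Pb; apply/negP => /hP;
  rewrite (negPf Pa) (negPf Pb). Qed.

Lemma primeX P a k : prime_ideal P -> a ^+ k \in P -> a \in P.
Proof.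
move=> hP; apply: contraTT => Pa; elim: k => [|k IH]; first exact: ideal1 hP.1.
by rewrite exprS; apply: primeM.
Qed.

Lemma nzd_modM I a b : nzd_mod I a -> nzd_mod I b -> nzd_mod I (a * b).
Proof. by move=> ha hb c; rewrite -mulrA => /ha /hb. Qed.

Lemma nzd_modX I a k : nzd_mod I a -> nzd_mod I (a ^+ k).
Proof.
move=> ha; elim: k => [|k IH]; first by move=> c; rewrite mul1r.
by rewrite exprS; apply: nzd_modM.
Qed.

(** When [I] is generated by a regular sequence in [P], this says that the
    sequence cannot be prolonged inside [P]. *)
Definition degenerate I P : Prop := forall z, z \in P -> ~ nzd_mod I z.

(** The chain condition for the powers of [a]. *)
Lemma pi_regular I a : dcc_mod I ->
  exists k c d, nzd_mod I d /\ a ^+ k * (d - a * c) \in I.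
Proof.
move=> /(_ (fun=> a))[k [c [d [d_nzd]]]]; rewrite !prodr_const !card_ord => E.
by exists k, c, d; split=> //; rewrite mulrBr mulrA -exprSr mulrC [_ * c]mulrC.
Qed.

(** [a] and [a * r] generate the same principal ideal in the total quotient
    ring of the ring modulo [I]. *)
Definition absorbs I a r : Prop :=
  exists c d, nzd_mod I d /\ d * a - c * (a * r) \in I.

(** Well-founded induction on principal ideals: [a * r] is smaller than [a] when
    [r] is not absorbed. An infinite descent would start at 1 and produce the
    partial products of some sequence. *)
Lemma dcc_ind I (S : A -> Prop) : dcc_mod I ->
  (forall a, (forall r, ~ absorbs I a r -> S (a * r)) -> S a) -> S 1.
Proof.
move=> dcc step; apply: contrapT => nS1.
have next a : exists r, ~ S a -> ~ absorbs I a r /\ ~ S (a * r).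
  have [Sa|nSa] := pselect (S a); first by exists 0.
  apply: contrapT => h; apply: nSa; apply: step => r nabs.
  by apply: contrapT => nS; apply: h; exists r.
have [f fP] := choice next.
pose s := fix s i := if i is i'.+1 then s i' * f (s i') else 1.
have sE i : s i = \prod_(j < i) f (s j).
  by elim: i => [|i IH]; rewrite ?big_ord0 // big_ord_recr /= -IH.
have nS i : ~ S (s i) by elim: i => //= i IH; case: (fP _ IH).
have [m [c [d [d_nzd E]]]] := dcc (fun i => f (s i)).
case: (fP _ (nS m)) => nabs _; apply: nabs; exists c, d; split=> //.
by move: E; rewrite -!sE.
Qed.

(** In the total quotient ring, if [a * r] and [a * r'] together generate the
    ideal of [a], an element that multiplies each of their two ideals onto
    itself does the same for the ideal of [a]. *)
Lemma absorbs_split I a r r' : idealr_closed I ->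
  absorbs I a (r + r') ->
  forall z, absorbs I (a * r) z -> absorbs I (a * r') z -> absorbs I a z.
Proof.
move=> hI [f [e [he E]]] z [c [d [hd D]]] [c' [d' [hd' D']]].
exists (f * (d' * c * r + d * c' * r')), (e * (d * d')); split.
  by do ! apply: nzd_modM.
have -> : e * (d * d') * a - f * (d' * c * r + d * c' * r') * (a * z) =
  (d * d') * (e * a - f * (a * (r + r'))) +
  (f * d' * (d * (a * r) - c * (a * r * z)) +
   f * d * (d' * (a * r') - c' * (a * r' * z))) by ring.
by apply: idealD => //; [|apply: idealD => //]; apply: ideal_mull.
Qed.

(** The induction produces, for each [a], finitely many primes outside which all
    the elements are absorbed by [a]; for [a = 1] these elements are regular.
    If the elements that [a] does not absorb form an ideal, this ideal is
    prime, and it is enough. Otherwise two of them, [r] and [r'], have a sum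
    that is absorbed, and the primes of [a * r] and [a * r'] together are
    enough. *)
Lemma finite_primes I : idealr_closed I -> dcc_mod I ->
  exists L, (forall X, X \in L ->
      [/\ prime_ideal X, {subset I <= X} & degenerate I X]) /\
    forall z, (forall X, X \in L -> z \notin X) -> nzd_mod I z.
Proof.
move=> hI dcc.
pose S a := exists L, (forall X, X \in L ->
      [/\ prime_ideal X, {subset I <= X} & degenerate I X]) /\
    forall z, (forall X, X \in L -> z \notin X) -> absorbs I a z.
suff [L [LP Labs]] : S 1.
  exists L; split=> // z /Labs[c [d [hd E]]] a za; apply: hd.
  have -> : d * a = a * (d * 1 - c * (1 * z)) + c * (z * a) by ring.
  by apply: idealD => //; apply: ideal_mull.
apply: (dcc_ind dcc) => a IH.
have [Ia|/negP nIa] := boolP (a \in I).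
  exists [::]; split=> // z _; exists 0, 1; split; first by move=> b;
    rewrite mul1r.
  by rewrite mul0r subr0 mul1r.
have [[r [r' [nr nr' rr']]]|addN] :=
    pselect (exists r r', [/\ ~ absorbs I a r,
      ~ absorbs I a r' & absorbs I a (r + r')]).
  have [[L [LP Labs]] [L' [LP' Labs']]] := (IH r nr, IH r' nr').
  exists (L ++ L'); split=> [X|z zL];
    first by rewrite mem_cat => /orP[/LP|/LP'].
  apply: (absorbs_split hI rr').
    by apply: Labs => X XL; apply: zL; rewrite mem_cat XL.
  by apply: Labs' => X XL; apply: zL; rewrite mem_cat XL orbT.
pose X : A -> bool := fun r => `[< ~ absorbs I a r >].
have XP r : (r \in X) <-> ~ absorbs I a r by split=> [/asboolP|h];
  last apply/asboolP.
have nXP r : (r \notin X) -> absorbs I a r.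
  by move=> /negP nX; apply: contrapT => /XP.
have IX : {subset I <= X}.
  move=> i Ii; apply/XP => -[c [d [hd E]]]; apply: nIa; apply: hd.
  by apply: (ideal_subr hI E); apply: ideal_mull => //; apply: ideal_mull.
have nzdX d : nzd_mod I d -> d \notin X.
  move=> hd; apply/negP => /XP; apply; exists 1, d; split=> //.
  by rewrite mul1r mulrC subrr; apply: ideal0.
exists [:: X]; split=> [X'|z /(_ X)]; last by rewrite inE eqxx => /(_ isT)/nXP.
rewrite inE => /eqP->; split=> //; last by move=> z zX /nzdX; rewrite zX.
split; first split=> [||b u v /XP nu /XP nv].
- by apply: IX; apply: ideal0.
- by apply: nzdX => b; rewrite mul1r.
- apply/XP => abs; apply: addN; exists (b * u), v; split=> // -[c [d [hd E]]].
  apply: nu; exists (c * b), d; split=> //.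
  by rewrite (_ : c * b * (a * u) = c * (a * (b * u))) //; ring.
move=> u v; apply: contraTT; rewrite negb_or =>
  /andP[/nXP[c [d [hd D]]] /nXP[c' [d' [hd' D']]]].
apply/negP => /XP; apply; exists (c * c'), (d * d'); split;
  first exact: nzd_modM.
have -> : d * d' * a - c * c' * (a * (u * v)) =
  d' * (d * a - c * (a * u)) + c * u * (d' * a - c' * (a * v)) by ring.
by apply: idealD => //; apply: ideal_mull.
Qed.

(** For [q] outside [P], the relation q ^+ k * (d - q * c) \in I makes [d]
    congruent to a multiple of [q] modulo [P]. So [Q] would contain the regular
    element [d] if it contained [q]. *)
Lemma degenerate_incomparable I P Q : idealr_closed I -> dcc_mod I ->
  prime_ideal P -> prime_ideal Q -> {subset I <= P} -> {subset P <= Q} ->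
  degenerate I Q -> {subset Q <= P}.
Proof.
move=> hI dcc hP hQ IP PQ degQ q Qq; apply/negPn/negP => nPq.
have [k [c [d [hd /IP]]]] := pi_regular q dcc.
apply/negP; apply: primeM => //; first by apply: contra nPq => /(primeX hP).
apply/negP => /PQ Qd; apply: (degQ d) => //; apply: (ideal_subr hQ.1 Qd).
exact: ideal_mulr hQ.1 Qq.
Qed.

Lemma common_outside P L : prime_ideal P ->
  (forall X, X \in L -> idealr_closed X /\ ~ {subset X <= P}) ->
  exists2 g, g \notin P & forall X, X \in L -> g \in X.
Proof.
move=> hP; elim: L => [|Y L IH] LP; first by exists 1 => //; apply: ideal1 hP.1.
have [X XL|g nPg gL] := IH; first by apply: LP; rewrite inE XL orbT.
have [y Yy nPy] : exists2 y, y \in Y & y \notin P.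
  apply: contrapT => h; case: (LP Y (mem_head _ _)) => _; apply.
  by move=> y Yy; apply/negPn/negP => nPy; apply: h; exists y.
exists (y * g); first exact: primeM.
move=> X XL'; have [hX _] := LP X XL'.
move: XL'; rewrite inE => /orP[/eqP eX|/gL]; last exact: ideal_mull.
by apply: ideal_mulr => //; rewrite eX.
Qed.

Lemma prime_avoidance J L : idealr_closed J ->
  (forall X, X \in L -> prime_ideal X /\ exists2 x, x \in J & x \notin X) ->
  exists2 v, v \in J & forall X, X \in L -> v \notin X.
Proof.
move=> hJ; have [n] := ubnP (size L); elim: n L => // n IH [|P L] /=.
  by move=> _ _; exists 0 => //; apply: ideal0.
rewrite ltnS => sL LP.
have LP' X : X \in L -> prime_ideal X /\ exists2 x, x \in J & x \notin X.
  by move=> XL; apply: LP; rewrite inE XL orbT.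
have [[X XL XP]|noX] := pselect (exists2 X, X \in L & {subset X <= P}).
  (* Avoiding [P] entails avoiding [X], which can be dropped. *)
  have [||v Jv vL] := IH (P :: rem X L).
  - by rewrite /= size_rem //; case: (L) XL sL.
  - move=> Y; rewrite inE => /orP[/eqP->|/mem_rem/LP' //]; apply: LP;
    exact: mem_head.
  have nPv : v \notin P by apply: vL; apply: mem_head.
  exists v => // Y; rewrite inE => /orP[/eqP-> //|YL].
  have [->|neq] := eqVneq Y X; first by apply: contra nPv => /XP.
  apply: vL; rewrite inE; apply/orP; right.
  have := perm_mem (perm_to_rem XL) Y.
  by rewrite YL inE (negPf neq) /= => <-.
have [v Jv vL] := IH L sL LP'.
have [hP [u Ju nPu]] := LP P (mem_head _ _).
have [Pv|nPv] := boolP (v \in P); last first.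
  by exists v => // Y; rewrite inE => /orP[/eqP-> //|/vL].
have [g nPg gL] : exists2 g, g \notin P & forall X, X \in L -> g \in X.
  apply: common_outside => // X XL; split; first by case: (LP' X XL) => -[].
  by move=> XP; apply: noX; exists X.
exists (v + u * g); first by apply: idealD => //; apply: ideal_mulr.
move=> Y; rewrite inE => /orP[/eqP->|YL].
  by apply: contra (primeM hP nPu nPg) => h; have := idealB hP.1 h Pv;
    rewrite addrAC subrr add0r.
have [[hY _] _] := LP' Y YL.
apply: contra (vL Y YL) => h; have := idealB hY h (ideal_mull u hY (gL Y YL)).
by rewrite addrK.
Qed.

(** In the total quotient ring of the ring modulo [I], a finite product of local
    rings, [g] lives on the local factor of [P] and is invertible there, while
    [v] lives on the other factors and is invertible there. To get them, take
    [g0] outside [P] and in the other primes of zero-divisors, [v0] in [P] and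
    outside the others: their product is nilpotent, and a power of each will
    do. *)
Lemma isolating_pair I P : idealr_closed I -> dcc_mod I ->
  prime_ideal P -> {subset I <= P} -> degenerate I P ->
  exists g v, [/\ g \notin P, v \in P, g * v \in I &
    forall q, q \notin P -> nzd_mod I (q * g + v)].
Proof.
move=> hI dcc hP IP degP; have [L0 [L0P L0nzd]] := finite_primes hI dcc.
pose L := [seq X <- L0 | X != P].
have LP X : X \in L -> [/\ prime_ideal X, {subset I <= X},
  degenerate I X & X != P].
  by rewrite mem_filter => /andP[XP /L0P[]].
have Lnzd z : z \notin P -> (forall X, X \in L -> z \notin X) -> nzd_mod I z.
  move=> nPz zL; apply: L0nzd => X XL0; have [-> //|XP] := eqVneq X P.
  by apply: zL; rewrite mem_filter XP.
have XeP X : {subset X <= P} -> {subset P <= X} -> X = P.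
  by move=> XP PX; apply/funext => x; apply/idP/idP => [/XP|/PX].
have [v0 Pv0 v0L] : exists2 v, v \in P & forall X, X \in L -> v \notin X.
  apply: prime_avoidance => [|X XL]; first exact: hP.1.
  have [hX IX degX neq] := LP X XL; split=> //; apply: contrapT => h.
  have PX : {subset P <= X}.
    by move=> x Px; apply/negPn/negP => nXx; apply: h; exists x.
  move/eqP: neq; apply; apply: XeP => //.
  exact: (degenerate_incomparable hI dcc hP hX IP PX degX).
have [g0 nPg0 g0L] : exists2 g, g \notin P & forall X, X \in L -> g \in X.
  apply: common_outside => // X XL.
  have [hX IX degX neq] := LP X XL; split; first exact: hX.1.
  move=> XP; move/eqP: neq; apply; apply: XeP => //.
  exact: (degenerate_incomparable hI dcc hX hP IX XP degP).
have [k [c [d [hd E]]]] := pi_regular (g0 * v0) dcc.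
have nzd_d : nzd_mod I (d - g0 * v0 * c).
  apply: Lnzd => [|X XL].
    apply/negP => h; apply: (degP d) => //; apply: (ideal_subr hP.1 h).
    by apply: ideal_mulr hP.1 _; apply: ideal_mull hP.1 _.
  have [hX _ degX _] := LP X XL.
  apply/negP => h; apply: (degX d) => //; apply: (ideal_subr hX.1 h).
  by apply: ideal_mulr hX.1 _; apply: ideal_mulr hX.1 _; apply: g0L.
have {E}nil : (g0 * v0) ^+ k \in I by apply: nzd_d; rewrite mulrC.
(* The exponent [k] can be 0, and [g] and [v] must stay in the primes of [g0]
   and [v0]. *)
exists (g0 ^+ k.+1), (v0 ^+ k.+1); split.
- by apply: contra nPg0 => /(primeX hP).
- by rewrite exprS; apply: ideal_mulr hP.1 _.
- by rewrite -exprMn exprS; apply: ideal_mull.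
move=> q nPq; apply: Lnzd => [|X XL].
  have Pv : v0 ^+ k.+1 \in P by rewrite exprS; apply: ideal_mulr hP.1 _.
  apply/negP => h; have := idealB hP.1 h Pv; rewrite addrK; apply/negP.
  by apply: primeM => //; apply: contra nPg0 => /(primeX hP).
have [hX _ _ _] := LP X XL.
have Xqg : q * g0 ^+ k.+1 \in X.
  by rewrite exprS; apply: ideal_mull hX.1 _; apply: ideal_mulr hX.1 _;
    apply: g0L.
apply/negP => h; have := idealB hX.1 h Xqg; rewrite addrAC subrr add0r.
by apply/negP; apply: contra (v0L X XL) => /(primeX hX).
Qed.

Lemma isolating_pair_nzd I P p c d g v : prime_ideal P -> degenerate I P ->
  nzd_mod I d ->
  p \in P -> (forall q, q \notin P -> nzd_mod I (q * g + v)) ->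
  nzd_mod I ((d - p * c) * g + v).
Proof.
move=> hP degP hd Pp; apply; apply/negP => h; apply: (degP d) => //.
by apply: (ideal_subr hP.1 h); apply: ideal_mulr hP.1 _.
Qed.

(** [g] lives on a local factor whose maximal ideal, coming from [P], is nil. *)
Lemma isolating_pair_nil I P g v p : idealr_closed I -> dcc_mod I ->
  prime_ideal P -> degenerate I P -> g * v \in I ->
  (forall q, q \notin P -> nzd_mod I (q * g + v)) ->
  p \in P -> exists k, p ^+ k * g \in I.
Proof.
move=> hI dcc hP degP gv nzd Pp; have [k [c [d [hd E]]]] := pi_regular p dcc.
exists k; apply: (isolating_pair_nzd (c := c) hP degP hd Pp nzd).
have -> : ((d - p * c) * g + v) * (p ^+ k * g) =
  g * g * (p ^+ k * (d - p * c)) + p ^+ k * (g * v) by ring.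
by apply: idealD => //; apply: ideal_mull.
Qed.

(** Otherwise each element outside [I] stays outside [I] after multiplication by
    a suitable element of [P]. Starting from [g] this gives a sequence of
    products; the chain condition makes one of them killed by some
    d - p * c with [p] in [P] and [d] regular. That is impossible, as
    d - p * c is invertible on the factor where [g] lives. *)
Lemma degenerate_annihilator I P : idealr_closed I -> dcc_mod I ->
  prime_ideal P -> {subset I <= P} -> degenerate I P ->
  exists2 b, b \notin I & forall p, p \in P -> p * b \in I.
Proof.
move=> hI dcc hP IP degP.
have [g [v [nPg _ gv nzd]]] := isolating_pair hI dcc hP IP degP.
apply: contrapT => noann.
have next b : exists p, b \notin I -> p \in P /\ b * p \notin I.
  have [Ib|nIb] := boolP (b \in I); first by exists 0.
  apply: contrapT => h; apply: noann; exists b => // p Pp.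
  by apply/negPn/negP => npb; apply: h; exists p => _; rewrite mulrC.
have [f fP] := choice next.
pose s := fix s i := if i is i'.+1 then s i' * f (s i') else g.
have sE i : s i = g * \prod_(j < i) f (s j).
  by elim: i => [|i IH]; rewrite ?big_ord0 ?mulr1 // big_ord_recr /= mulrA -IH.
have nI i : s i \notin I.
  by elim: i => /= [|i /fP[]//]; apply: contra nPg => /IP.
have [m [c [d [hd E]]]] := dcc (fun i => f (s i)).
have [Pf _] := fP _ (nI m).
move/negP: (nI m); apply.
apply: (isolating_pair_nzd (c := c) hP degP hd Pf nzd).
rewrite {2}sE; move: E; rewrite big_ord_recr /=; set pm := \prod_(i < m) _ => E.
have -> : ((d - f (s m) * c) * g + v) * (g * pm) =
  g * g * (d * pm - c * (pm * f (s m))) + pm * (g * v) by ring.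
by apply: idealD => //; apply: ideal_mull.
Qed.

Definition adjoin I x : A -> bool := fun a => `[< exists c, a - c * x \in I >].

Lemma adjoinP I x a : a \in adjoin I x <-> exists c, a - c * x \in I.
Proof. by split=> [/asboolP|h]; last apply/asboolP. Qed.

Lemma sub_adjoin I x : {subset I <= adjoin I x}.
Proof. by move=> a Ia; apply/adjoinP; exists 0; rewrite mul0r subr0. Qed.

Lemma mem_adjoin I x : idealr_closed I -> x \in adjoin I x.
Proof. by move=> hI; apply/adjoinP; exists 1; rewrite mul1r subrr;
  apply: ideal0. Qed.

Lemma adjoin_sub I x Q : idealr_closed Q -> {subset I <= Q} -> x \in Q ->
  {subset adjoin I x <= Q}.
Proof.
move=> hQ IQ Qx a /adjoinP[c /IQ h]; apply: (ideal_subr hQ h).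
exact: ideal_mull.
Qed.

Lemma adjoin_closed I x : idealr_closed I -> 1 \notin adjoin I x ->
  idealr_closed (adjoin I x).
Proof.
move=> hI n1; split=> // [|a u v /adjoinP[c hc] /adjoinP[d hd]].
  by apply: sub_adjoin; apply: ideal0.
apply/adjoinP; exists (a * c + d).
have -> : a * u + v - (a * c + d) * x = a * (u - c * x) + (v - d * x) by ring.
by apply: idealD => //; apply: ideal_mull.
Qed.

Lemma adjoin_ideal I x Q : idealr_closed I -> idealr_closed Q ->
  {subset I <= Q} -> x \in Q -> idealr_closed (adjoin I x).
Proof.
move=> hI hQ IQ Qx; apply: adjoin_closed => //; apply/negP.
by move=> /(adjoin_sub hQ IQ Qx); apply/negP; apply: ideal1.
Qed.

Lemma adjoinC I x z : adjoin (adjoin I x) z = adjoin (adjoin I z) x.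
Proof.
apply/funext => a; apply/asboolP/asboolP => -[c /adjoinP[d h]].
  by exists d; apply/adjoinP; exists c; rewrite addrAC.
by exists d; apply/adjoinP; exists c; rewrite addrAC.
Qed.

(** If [b] is killed by [Q] modulo [(I, x)], then z * b = c * x modulo [I] for
    some [c], and [c] is killed by [Q] modulo [(I, z)]: multiplication by the
    fraction z / x exchanges the elements killed by [Q] in the two quotients. *)
Lemma degenerate_exchange I Q x z : idealr_closed I -> prime_ideal Q ->
  {subset I <= Q} -> x \in Q -> z \in Q -> nzd_mod I x -> nzd_mod I z ->
  dcc_mod (adjoin I x) -> degenerate (adjoin I x) Q ->
    degenerate (adjoin I z) Q.
Proof.
move=> hI hQ IQ Qx Qz hx hz dcc degx y Qy hy.
have [||b nb Qb] := degenerate_annihilator _ dcc hQ _ degx.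
- exact: adjoin_ideal hQ.1 IQ Qx.
- exact: adjoin_sub hQ.1 IQ Qx.
have /adjoinP[c zb] := Qb z Qz.
have nc : c \notin adjoin I z.
  apply: contra nb => /adjoinP[e ce]; apply/adjoinP; exists e; apply: hz.
  have -> : z * (b - e * x) = (z * b - c * x) + x * (c - e * z) by ring.
  by apply: idealD => //; apply: ideal_mull.
move/negP: nc; apply; apply: hy; apply/adjoinP.
have /adjoinP[e yb] := Qb y Qy; exists e; apply: hx.
have -> : x * (y * c - e * z) =
  z * (y * b - e * x) - y * (z * b - c * x) by ring.
by apply: idealB => //; apply: ideal_mull.
Qed.

End Ideals.

(** * Uniqueness of the length of maximal regular sequences *)

Section RegularSequences.
Variable A : comNzRingType.
Implicit Types (I J K P Q X : A -> bool) (L : seq (A -> bool)).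
Implicit Types s t x y : seq A.

(** Regular sequences in a form suited to induction: the base ideal [I] grows
    with the elements that are consumed. Properness is left out, since it is
    automatic for sequences inside a proper ideal. *)
Fixpoint reg_mod I s : Prop :=
  if s is a :: s' then nzd_mod I a /\ reg_mod (adjoin I a) s' else True.

Definition ideal_span I s : A -> bool := foldl (@adjoin A) I s.

(** Only the proper prefixes of [s] count: the last element of a maximal
    sequence is the one that [z] replaces. *)
Fixpoint nzd_mod_prefixes I (z : A) s : Prop :=
  if s is a :: s' then nzd_mod I z /\ nzd_mod_prefixes (adjoin I a) z s' else
    True.

(** What is retained of [regularly_subperfect], relative to a base ideal. *)
Definition regularly_dcc Q I : Prop :=
  forall s, {subset s <= Q} -> reg_mod I s -> dcc_mod (ideal_span I s).

Lemma reg_mod_cat I s t :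
  reg_mod I (s ++ t) <-> reg_mod I s /\ reg_mod (ideal_span I s) t.
Proof.
elim: s I => [|a s IH] I /=; first by split=> // -[].
by rewrite IH; split=> [[? []]|[[]]].
Qed.

Lemma reg_mod_rcons I s a :
  reg_mod I (rcons s a) <-> reg_mod I s /\ nzd_mod (ideal_span I s) a.
Proof. by rewrite -cats1 reg_mod_cat /=; split=> [[? []]|[]]. Qed.

Lemma span_rcons I s a : ideal_span I (rcons s a) = adjoin (ideal_span I s) a.
Proof. by rewrite /ideal_span foldl_rcons. Qed.

Lemma sub_consl (Q : A -> bool) a s : {subset a :: s <= Q} ->
  a \in Q /\ {subset s <= Q}.
Proof.
by move=> h; split=> [|b bs]; apply: h; rewrite inE ?eqxx // bs orbT.
Qed.

Lemma sub_consr (Q : A -> bool) a s : a \in Q -> {subset s <= Q} ->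
  {subset a :: s <= Q}.
Proof. by move=> Qa sQ b; rewrite inE => /orP[/eqP->|/sQ]. Qed.

Lemma sub_rconsl (Q : A -> bool) a s : {subset rcons s a <= Q} ->
  a \in Q /\ {subset s <= Q}.
Proof.
by move=> h; split=> [|b bs]; apply: h; rewrite mem_rcons inE ?eqxx // bs orbT.
Qed.

Lemma sub_rconsr (Q : A -> bool) a s : a \in Q -> {subset s <= Q} ->
  {subset rcons s a <= Q}.
Proof. by move=> Qa sQ b; rewrite mem_rcons inE => /orP[/eqP->|/sQ]. Qed.

Lemma span_ideal I Q s : idealr_closed I -> idealr_closed Q ->
  {subset I <= Q} -> {subset s <= Q} ->
  idealr_closed (ideal_span I s) /\ {subset ideal_span I s <= Q}.
Proof.
move=> + hQ; elim: s I => [|a s IH] I hI IQ //= /sub_consl[Qa sQ].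
by apply: IH => //; [apply: adjoin_ideal hQ IQ Qa | apply: adjoin_sub].
Qed.

Lemma regularly_dcc_adjoin I Q z : z \in Q -> nzd_mod I z ->
  regularly_dcc Q I -> regularly_dcc Q (adjoin I z).
Proof. by move=> Qz hz dcc s sQ hs; apply: (dcc (z :: s)) => //;
  apply: sub_consr. Qed.

(** The primes of zero-divisors modulo the proper prefixes. None of them
    contains [Q], because the next element of the sequence is regular. *)
Lemma prefix_primes I Q s : idealr_closed I -> idealr_closed Q ->
  {subset I <= Q} -> regularly_dcc Q I -> {subset s <= Q} -> reg_mod I s ->
  exists L, (forall X, X \in L ->
    prime_ideal X /\ exists2 q, q \in Q & q \notin X) /\
    forall z, (forall X, X \in L -> z \notin X) -> nzd_mod_prefixes I z s.
Proof.
move=> + hQ; elim: s I => [|a s IH] I hI IQ dcc /=; first by exists [::].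
move=> /sub_consl[Qa sQ] [ha hs].
have [|||L [LP Lz]] := IH (adjoin I a) _ _ _ sQ hs.
- exact: adjoin_ideal hQ IQ Qa.
- exact: adjoin_sub.
- exact: regularly_dcc_adjoin.
have dccI : dcc_mod I by apply: (dcc [::]).
have [L0 [L0P L0z]] := finite_primes hI dccI.
exists (L0 ++ L); split=> [X|z zL].
  rewrite mem_cat => /orP[/L0P[hX _ degX]|/LP//]; split=> //.
  by exists a => //; apply/negP => /degX.
by split; [apply: L0z | apply: Lz] => X XL; apply: zL; rewrite mem_cat XL ?orbT.
Qed.

Lemma nzd_swap I (y z : A) : idealr_closed I -> nzd_mod I y ->
  nzd_mod (adjoin I y) z -> nzd_mod (adjoin I z) y.
Proof.
move=> hI hy hz a /adjoinP[c ya].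
have /hz/adjoinP[e ce] : z * c \in adjoin I y.
  apply/adjoinP; exists a; rewrite (_ : _ - _ = 0 - (y * a - c * z));
    last by ring.
  by apply: idealB => //; apply: ideal0.
apply/adjoinP; exists e; apply: hy.
have -> : y * (a - e * z) = (y * a - c * z) + z * (c - e * y) by ring.
by apply: idealD => //; apply: ideal_mull.
Qed.

(** Iterating [nzd_swap] moves [z] from the end of the sequence to its front;
    this is where [z] must be regular modulo all the prefixes, as in general
    regular sequences cannot be permuted. *)
Lemma move_front I Q (z : A) s a : idealr_closed I -> idealr_closed Q ->
  {subset I <= Q} -> {subset s <= Q} ->
  nzd_mod_prefixes I z (rcons s a) -> reg_mod I (rcons s a) ->
  [/\ nzd_mod I z, reg_mod (adjoin I z) s, nzd_mod (ideal_span I s) z &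
      ideal_span (adjoin I z) s = adjoin (ideal_span I s) z].
Proof.
move=> + hQ; elim: s I => [|y s IH] I hI IQ /=; first by move=> _ [hz _] _.
move=> /sub_consl[Qy sQ] [hz zs] [hy ys].
have [||hz' h1 h2 h3] := IH (adjoin I y) _ _ sQ zs ys.
- exact: adjoin_ideal hQ IQ Qy.
- exact: adjoin_sub.
by split=> //; rewrite adjoinC //; split=> //; apply: nzd_swap.
Qed.

(** By prime avoidance [Q] contains a [z] that is regular modulo all the proper
    prefixes of the two sequences. Let it replace the last element of each and
    move it to the front: modulo [z], what is left of the two sequences is
    maximal regular in [Q] and one element shorter. *)
Lemma regular_length_unique Q : prime_ideal Q -> forall k I x y,
  idealr_closed I -> {subset I <= Q} -> regularly_dcc Q I ->
  {subset x <= Q} -> {subset y <= Q} -> reg_mod I x -> reg_mod I y ->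
  degenerate (ideal_span I x) Q -> degenerate (ideal_span I y) Q ->
  size x = k -> size y = k.
Proof.
move=> hQ; elim=> [|k IH] I x y hI IQ dcc xQ yQ hx hy degx degy.
  move=> /size0nil ex; rewrite {x}ex /= in degx xQ hx.
  by case: y hy yQ {degy} => //= a y [ha _] /sub_consl[/degx].
case/lastP: x xQ hx degx => [//|x a] axQ hx degx.
rewrite size_rcons => -[sx]; case/lastP: y yQ hy degy => [|y b] byQ hy degy.
  by case: x axQ hx {degx sx} => /= [|x0 x] /sub_consl[/degy nx0 _] [/nx0].
have [Qa xQ] := sub_rconsl axQ; have [Qb yQ] := sub_rconsl byQ.
have [Lx [LxP Lxz]] := prefix_primes hI hQ.1 IQ dcc axQ hx.
have [Ly [LyP Lyz]] := prefix_primes hI hQ.1 IQ dcc byQ hy.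
have [z Qz zL] : exists2 z, z \in Q & forall X, X \in Lx ++ Ly -> z \notin X.
  apply: prime_avoidance => [|X]; first exact: hQ.1.
  by rewrite mem_cat => /orP[/LxP|/LyP].
have zx : nzd_mod_prefixes I z (rcons x a).
  by apply: Lxz => X XL; apply: zL; rewrite mem_cat XL.
have zy : nzd_mod_prefixes I z (rcons y b).
  by apply: Lyz => X XL; apply: zL; rewrite mem_cat XL orbT.
have [hz x1 x2 x3] := move_front hI hQ.1 IQ xQ zx hx.
have [_ y1 y2 y3] := move_front hI hQ.1 IQ yQ zy hy.
have [sxI sxQ] := span_ideal hI hQ.1 IQ xQ.
have [syI syQ] := span_ideal hI hQ.1 IQ yQ.
have dccx := dcc _ axQ hx; have dccy := dcc _ byQ hy.
rewrite !span_rcons in dccx dccy degx degy.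
have [_ ax] := (reg_mod_rcons I x a).1 hx.
have [_ yb] := (reg_mod_rcons I y b).1 hy.
rewrite size_rcons; congr _.+1; apply: (IH (adjoin I z) x y) => //.
- exact: adjoin_ideal hQ.1 IQ Qz.
- exact: adjoin_sub hQ.1 IQ Qz.
- exact: regularly_dcc_adjoin.
- by rewrite x3; apply: (degenerate_exchange sxI hQ sxQ Qa Qz ax x2).
- by rewrite y3; apply: (degenerate_exchange syI hQ syQ Qb Qz yb y2).
Qed.

Definition zero_ideal : A -> bool := fun a => a == 0.

Lemma mem_zero (a : A) : (a \in zero_ideal) = (a == 0). Proof. by []. Qed.

Lemma zero_closed : idealr_closed zero_ideal.
Proof.
split; rewrite ?mem_zero ?oner_eq0 // => a u v.
by rewrite !mem_zero => /eqP-> /eqP->; rewrite mulr0 addr0.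
Qed.

Lemma sub_zero I : idealr_closed I -> {subset zero_ideal <= I}.
Proof. by move=> hI a; rewrite mem_zero => /eqP->; apply: ideal0. Qed.

Lemma gen_ideal_natP s a : a \in gen_ideal s <->
  exists c : nat -> A, a = \sum_(i < size s) c i * s`_i.
Proof.
split=> [/asboolP[c ->]|[c ->]]; last by apply/asboolP; exists (fun i => c i).
exists (fun i => if insub i is Some j then c j else 0).
by apply: eq_bigr => i _; rewrite valK.
Qed.

Lemma gen_ideal_span s : gen_ideal s = ideal_span zero_ideal s.
Proof.
suff E b : (b \in gen_ideal s) =
  (b \in ideal_span zero_ideal s) by apply/funext => b; apply: E.
elim/last_ind: s b => [|s a IH] b.
  rewrite mem_zero; apply/idP/eqP => [/gen_ideal_natP[c ->]|->];
    first by rewrite big_ord0.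
  by apply/gen_ideal_natP; exists (fun=> 0); rewrite big_ord0.
have sumE (c : nat -> A) : \sum_(i < (size s).+1) c i * (rcons s a)`_i =
    \sum_(i < size s) c i * s`_i + c (size s) * a.
  rewrite big_ord_recr /= nth_rcons ltnn eqxx; congr (_ + _).
  by apply: eq_bigr => i _; rewrite nth_rcons ltn_ord.
rewrite span_rcons; apply/idP/idP => [/gen_ideal_natP[c]|/adjoinP[e]].
  rewrite size_rcons sumE => ->; apply/adjoinP; exists (c (size s)).
  by rewrite addrK -IH; apply/gen_ideal_natP; exists c.
rewrite -IH => /gen_ideal_natP[c E]; apply/gen_ideal_natP.
pose c' i := if (i < size s)%N then c i else e; exists c'.
rewrite size_rcons sumE /c' ltnn -[LHS](subrK (e * a)) E; congr (_ + _).
by apply: eq_bigr => i _; rewrite ltn_ord.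
Qed.

Lemma regular_seqP s :
  regular_seq s <-> 1 \notin ideal_span zero_ideal s /\ reg_mod zero_ideal s.
Proof.
rewrite /regular_seq gen_ideal_span.
suff E : (forall j, (j < size s)%N -> nzd_mod (gen_ideal (take j s)) s`_j) <->
    reg_mod zero_ideal s.
  by split=> -[n1 /E h]; split.
elim/last_ind: s => [|s a IH]; first by split.
rewrite reg_mod_rcons -IH size_rcons -gen_ideal_span; split=> [h|[h ha] j].
  split=> [j js|].
    have := h j (ltnW js); rewrite nth_rcons js -cats1 takel_cat //;
      exact: ltnW.
  by have := h (size s) (ltnSn _);
    rewrite nth_rcons ltnn eqxx -cats1 take_size_cat.
rewrite ltnS leq_eqVlt => /orP[/eqP->|js].
  by rewrite nth_rcons ltnn eqxx -cats1 take_size_cat.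
by rewrite nth_rcons js -cats1 takel_cat ?(ltnW js) //; apply: h.
Qed.

End RegularSequences.

(** * Existence of primes, and the step to an adjacent prime *)

Section PrimeIdeals.
Variable A : comNzRingType.
Implicit Types (I J K M P Q X : A -> bool) (q t : A).

Lemma maximal_avoiding K (S : A -> Prop) : idealr_closed K -> S 1 ->
  (forall a, a \in K -> ~ S a) ->
  exists J, [/\ idealr_closed J, {subset K <= J}, forall a, a \in J -> ~ S a &
    forall J', idealr_closed J' -> (forall a, a \in J' -> ~ S a) ->
      {subset J <= J'} -> {subset J' <= J}].
Proof.
move=> hK S1 KS.
pose good J := [/\ idealr_closed J, {subset K <= J} & forall a, a \in J ->
  ~ S a].
pose T := {J : A -> bool | `[< good J >]}.
have gT (J : T) : good (val J) by apply/asboolP/(valP J).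
pose R : rel T := fun J1 J2 : T => `[< {subset val J1 <= val J2} >].
have gK : `[< good K >] by apply/asboolP; split.
have [|||J Jmax] := @ZL_preorder T (exist _ K gK) R.
- by move=> J; apply/asboolP.
- by move=> J1 J2 J3 /asboolP h1 /asboolP h2; apply/asboolP => a /h1/h2.
- move=> F tot; have [[J0 FJ0]|F0] := pselect (exists J : T, F J); last first.
    by exists (exist _ K gK) => J FJ; case: F0; exists J.
  pose U : A -> bool := fun a => `[< exists2 J : T, F J & a \in val J >].
  have UP a : (a \in U) <-> exists2 J : T, F J & a \in val J.
    by split=> [/asboolP|h]; last apply/asboolP.
  have gU : good U.
    split; first split.
    - by apply/UP; exists J0 => //; apply: ideal0; case: (gT J0).
    - by apply/negP => /UP[J _]; apply/negP; apply: ideal1; case: (gT J).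
    - move=> a u v /UP[J FJ uJ] /UP[J' FJ' vJ'].
      have [/asboolP h|/asboolP h] := tot _ _ FJ FJ'.
        apply/UP; exists J' => //; have [[_ _ hJ'] _ _] := gT J'.
        by apply: hJ' => //; apply: h.
      apply/UP; exists J => //; have [[_ _ hJ] _ _] := gT J.
      by apply: hJ => //; apply: h.
    - by move=> a Ka; apply/UP; exists J0 => //; case: (gT J0) => _ + _; apply.
    - by move=> a /UP[J _ aJ]; case: (gT J) => _ _; apply.
  have hU : `[< good U >] by apply/asboolP.
  by exists (exist _ U hU) => J FJ; apply/asboolP => a aJ; apply/UP; exists J.
have [hJ KJ JS] := gT J; exists (val J); split=> // J' hJ' J'S JJ'.
have gJ' : `[< good J' >] by apply/asboolP; split=> // a /KJ/JJ'.
by have /asboolP := Jmax (exist _ J' gJ') (asboolT JJ').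
Qed.

Lemma prime_avoiding K (S : A -> Prop) : idealr_closed K -> S 1 ->
  (forall a b, S a -> S b -> S (a * b)) -> (forall a, a \in K -> ~ S a) ->
  exists P, [/\ prime_ideal P, {subset K <= P} & forall a, a \in P -> ~ S a].
Proof.
move=> hK S1 SM KS; have [P [hP KP PS Pmax]] := maximal_avoiding hK S1 KS.
exists P; split=> //; split=> // u v Puv.
have meets x : x \notin P -> exists a c, S (a + c * x) /\ a \in P.
  move=> nPx; apply: contrapT => h; move/negP: nPx; apply.
  have hPx a : a \in adjoin P x -> ~ S a.
    move=> /adjoinP[c Pa] Sa; apply: h; exists (a - c * x), c.
    by rewrite subrK.
  apply: (Pmax (adjoin P x)) => //; last exact: mem_adjoin.
    by apply: adjoin_closed => //; apply/negP => /hPx.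
  exact: sub_adjoin.
apply/negPn/negP; rewrite negb_or =>
  /andP[/meets[a [c [Sa Pa]]] /meets[b [e [Sb Pb]]]].
apply: (PS _ _ (SM _ _ Sa Sb)).
have -> : (a + c * u) * (b + e * v) =
  (b + e * v) * a + (c * u * b + c * e * (u * v)) by ring.
by apply: idealD => //; [|apply: idealD => //]; apply: ideal_mull.
Qed.

Lemma maximal_above P : idealr_closed P ->
  exists2 M, maximal_ideal M & {subset P <= M}.
Proof.
move=> hP; have [//||M [hM PM _ Mmax]] :=
  @maximal_avoiding P (fun a => a = 1) hP.
  by move=> a Pa a1; move: Pa; rewrite a1; apply/negP; apply: ideal1.
exists M => //; split=> // J hJ MJ; apply: Mmax => // a Ja a1.
by move: Ja; rewrite a1; apply/negP; apply: ideal1.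
Qed.

Lemma maximal_prime M : maximal_ideal M -> prime_ideal M.
Proof.
move=> [hM Mmax]; have [//|||P [hP MP _]] :=
  @prime_avoiding M (fun a => a = 1) hM.
- by move=> a b -> ->; rewrite mulr1.
- by move=> a Ma a1; move: Ma; rewrite a1; apply/negP; apply: ideal1.
have -> // : M = P; apply/funext => a; apply/idP/idP => [/MP//|].
exact: (Mmax P hP.1 MP).
Qed.

(** An element of the localization at [Q] that is not nilpotent modulo [K] lies
    outside some prime that contains [K]. *)
Lemma prime_inside K Q q : idealr_closed K -> prime_ideal Q ->
  (forall k t, t \notin Q -> t * q ^+ k \notin K) ->
  exists P, [/\ prime_ideal P, {subset K <= P}, {subset P <= Q} & q \notin P].
Proof.
move=> hK hQ Kq.
have [|||P [hP KP PS]] :=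
    @prime_avoiding K (fun a => exists k t, t \notin Q /\ a = t * q ^+ k) hK.
- by exists 0%N, 1; rewrite mulr1; split=> //; apply: ideal1 hQ.1.
- move=> _ _ [k [t [nt ->]]] [l [t' [nt' ->]]]; exists (k + l)%N, (t * t').
  by split; [exact: primeM | rewrite exprD; ring].
- by move=> a Ka [k [t [nt E]]]; have := Kq k t nt; rewrite -E Ka.
exists P; split=> // [a Pa|].
  apply/negPn/negP => nQa; apply: (PS a Pa); exists 0%N, a.
  by rewrite mulr1.
apply/negP => Pq; apply: (PS q Pq); exists 1%N, 1; rewrite mul1r; split=> //.
exact: ideal1 hQ.1.
Qed.

Lemma subset_antisym P Q : {subset P <= Q} -> {subset Q <= P} -> P = Q.
Proof. by move=> PQ QP; apply/funext => a; apply/idP/idP => [/PQ|/QP]. Qed.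

Lemma subset_strict P Q : {subset P <= Q} -> P <> Q -> strict_sub P Q.
Proof.
move=> PQ neq; split=> //; apply: contrapT => h; apply: neq;
  apply: subset_antisym => //.
by move=> a Qa; apply/negPn/negP => nPa; apply: h; exists a.
Qed.

Definition adjacent P Q : Prop := strict_sub P Q /\
  ~ exists X, [/\ prime_ideal X, strict_sub P X & strict_sub X Q].

(** With an isolating pair [g], [v] of [P] and [q] in [Q] outside [P], let
    [w := q * g + v] and let [K] be the ideal of the [c] such that [c * g] is
    in [(I, w)]. It contains [q * g], which is not in [P], and a power of each
    element of [P]; it is contained in [Q]. So a prime between [K] and [Q]
    contains [P] strictly, and adjacency leaves only [Q]. Thus each [y] in [Q]
    is nilpotent modulo [K] locally at [Q]: were [y] regular modulo [(I, w)],
    some [t] outside [Q] would be in [K]. *)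
Lemma adjacent_degenerate I P Q : idealr_closed I -> dcc_mod I ->
  prime_ideal P -> prime_ideal Q -> {subset I <= P} -> degenerate I P ->
  adjacent P Q ->
  exists w, [/\ w \in Q, nzd_mod I w & degenerate (adjoin I w) Q].
Proof.
move=> hI dcc hP hQ IP degP [[PQ [q Qq nPq]] noX].
have [g [v [nPg Pv gv nzd]]] := isolating_pair hI dcc hP IP degP.
have Qw : q * g + v \in Q.
  by apply: idealD hQ.1 _ (PQ _ Pv); apply: ideal_mulr hQ.1 Qq.
set w := q * g + v in Qw.
have IQ : {subset I <= Q} by move=> a /IP/PQ.
have wI : idealr_closed (adjoin I w) by apply: adjoin_ideal hQ.1 _ Qw.
exists w; split=> [//||y Qy hy]; first exact: nzd.
pose K : A -> bool := fun c => c * g \in adjoin I w.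
have KP c : (c \in K) = (c * g \in adjoin I w) by [].
have KQ : {subset K <= Q}.
  move=> c; rewrite KP => /adjoinP[e E]; apply/negPn/negP => nQc.
  have : g * (g * (c - e * q)) \in I.
    have -> : g * (g * (c - e * q)) = g * (c * g - e * w) + e * (g * v).
      by rewrite /w; ring.
    by apply: idealD => //; apply: ideal_mull.
  move/IP; apply/negP; do 2 apply: primeM => //.
  by apply: contra nQc => /PQ h; apply: ideal_subr hQ.1 h _;
    apply: ideal_mull hQ.1 _.
have hK : idealr_closed K.
  split=> [||a c d]; rewrite ?KP.
  - by rewrite mul0r; apply: ideal0.
  - by apply/negP => h; have := KQ 1 h; apply/negP; apply: ideal1 hQ.1.
  - move=> Kc Kd; rewrite mulrDl -mulrA; apply: idealD => //; exact: ideal_mull.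
have [|X [hX KX XQ nXy]] := @prime_inside K Q y hK hQ.
  move=> k t nQt; apply/negP; rewrite KP mulrAC mulrC => /(nzd_modX hy).
  by rewrite -KP => /KQ; apply/negP.
apply: noX; exists X; split=> //; last by split=> //; exists y.
split=> [p Pp|].
  have [k pk] := isolating_pair_nil hI dcc hP degP gv nzd Pp.
  by apply: (@primeX _ _ _ k hX); apply: KX; rewrite KP; apply: sub_adjoin.
exists (q * g); last exact: primeM.
apply: KX; rewrite KP; apply/adjoinP; exists g.
have -> : q * g * g - g * w = 0 - g * v by rewrite /w; ring.
by apply: idealB => //; apply: ideal0.
Qed.

End PrimeIdeals.

(** * Depth and chains of primes *)

Section Depth.
Variable A : comNzRingType.
Implicit Types (I M P Q X : A -> bool) (c : nat -> A -> bool).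
Implicit Types (s t : seq A) (i j k m n : nat).

Local Notation Z := (@zero_ideal A).

Definition depth Q k : Prop := exists s : seq A,
  [/\ size s = k, {subset s <= Q}, reg_mod Z s & degenerate (ideal_span Z s) Q].

Hypothesis dccA : forall Q, idealr_closed Q -> regularly_dcc Q Z.
Hypothesis finA : ~ exists x : nat -> A, forall i, regular_seq (mkseq x i).

Lemma span_zero_sub Q s : idealr_closed Q -> {subset s <= Q} ->
  idealr_closed (ideal_span Z s) /\ {subset ideal_span Z s <= Q}.
Proof.
by move=> hQ; apply: span_ideal (zero_closed A) hQ (sub_zero hQ).
Qed.

(** Prolonging [s] for ever inside [Q] would give an infinite regular
    sequence. *)
Lemma extend_regular Q s : idealr_closed Q -> {subset s <= Q} -> reg_mod Z s ->
  exists t, [/\ {subset s ++ t <= Q},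
    reg_mod Z (s ++ t) & degenerate (ideal_span Z (s ++ t)) Q].
Proof.
move=> hQ sQ hs; apply: contrapT => h.
have next t : exists x, {subset s ++ t <= Q} -> reg_mod Z (s ++ t) ->
    x \in Q /\ nzd_mod (ideal_span Z (s ++ t)) x.
  have [[x [Qx hx]]|no] := pselect (exists x,
    x \in Q /\ nzd_mod (ideal_span Z (s ++ t)) x).
    by exists x.
  by exists 0 => tQ ht; case: h; exists t; split=> // x Qx hx; case: no;
    exists x.
have [f fP] := choice next.
pose e := fix e i := if i is i'.+1 then rcons (e i') (f (e i')) else [::].
have eP i : {subset s ++ e i <= Q} /\ reg_mod Z (s ++ e i).
  elim: i => [|i [IHQ IHr]]; first by rewrite cats0.
  have [Qx hx] := fP _ IHQ IHr; rewrite /= -rcons_cat; split;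
    first exact: sub_rconsr.
  by apply/reg_mod_rcons.
pose x i := if (i < size s)%N then s`_i else f (e (i - size s)%N).
have xE i : s ++ e i = mkseq x (size s + i).
  elim: i => [|i IH].
    rewrite cats0 addn0 -{1}(mkseq_nth 0 s); apply/eq_in_map => j.
    by rewrite mem_iota /x => /andP[_ ->].
  rewrite addnS mkseqS -IH /= -rcons_cat; congr rcons.
  by rewrite /x ltnNge leq_addr /= addKn.
apply: finA; exists x => i.
have take_mkseq : mkseq x i = take i (s ++ e i).
  have /minn_idPl le_i : (i <= size s + i)%N := leq_addl _ _.
  by rewrite xE /mkseq -map_take take_iota le_i.
have [eQ er] := eP i.
rewrite -(cat_take_drop i (s ++ e i)) -take_mkseq in eQ er.
have xQ : {subset mkseq x i <= Q} by move=> a ax; apply: eQ; rewrite mem_cat ax.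
apply/regular_seqP; split; last by case: ((reg_mod_cat _ _ _).1 er).
by apply/negP => /(span_zero_sub hQ xQ).2; apply/negP/ideal1.
Qed.

Lemma depth_exists Q : idealr_closed Q -> exists k, depth Q k.
Proof.
move=> hQ; have [//|//|t [tQ ht degt]] := @extend_regular Q [::] hQ.
by exists (size t), t.
Qed.

Lemma depth_unique Q j k : prime_ideal Q -> depth Q j -> depth Q k -> j = k.
Proof.
move=> hQ [s [<- sQ hs degs]] [t [<- tQ ht degt]]; apply/esym.
exact: (regular_length_unique hQ (zero_closed A) (sub_zero hQ.1)
  (dccA hQ.1) sQ tQ hs ht degs degt).
Qed.

(** A maximal regular sequence in [P] is not maximal in [Q]: the primes of
    zero-divisors modulo this sequence are incomparable. *)
Lemma depth_strict P Q i j : prime_ideal P -> prime_ideal Q -> strict_sub P Q ->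
  depth P i -> depth Q j -> (i < j)%N.
Proof.
move=> hP hQ [PQ [q Qq nPq]] [s [ss sP hs degs]] hj.
have sQ : {subset s <= Q} by move=> a /sP/PQ.
have [sI IP] := span_zero_sub hP.1 sP.
have dccs := dccA hP.1 sP hs.
have [x [Qx hx]] : exists x, x \in Q /\ nzd_mod (ideal_span Z s) x.
  apply: contrapT => h; move/negP: nPq; apply.
  apply: (degenerate_incomparable sI dccs hP hQ IP PQ _ Qq) => x Qx hx.
  by apply: h; exists x.
have [||t [tQ ht degt]] := @extend_regular Q (rcons s x) hQ.1.
- exact: sub_rconsr.
- by apply/reg_mod_rcons.
have -> : j = size (rcons s x ++ t).
  by apply: (depth_unique hQ hj); exists (rcons s x ++ t).
by rewrite size_cat size_rcons ss leq_addr.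
Qed.

Lemma depth_adjacent P Q i : prime_ideal P -> prime_ideal Q -> adjacent P Q ->
  depth P i -> depth Q i.+1.
Proof.
move=> hP hQ PQ [s [ss sP hs degs]].
have [sI IP] := span_zero_sub hP.1 sP.
have [w [Qw hw degw]] := adjacent_degenerate sI (dccA hP.1 sP hs) hP hQ IP degs
  PQ.
exists (rcons s w); rewrite size_rcons ss span_rcons; split=> //.
  by apply: sub_rconsr => // a /sP; case: PQ => -[PQ _] _; apply: PQ.
by apply/reg_mod_rcons.
Qed.

(** Among the primes that contain [P0] and are strictly inside [Q], one of
    maximal depth is adjacent to [Q]. *)
Lemma adjacent_below P0 Q j : prime_ideal P0 -> prime_ideal Q ->
  strict_sub P0 Q ->
  depth Q j -> exists P i, [/\ prime_ideal P, {subset P0 <= P},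
    strict_sub P Q, depth P i & j = i.+1].
Proof.
move=> hP0 hQ P0Q hj.
pose between i := `[< exists P, [/\ prime_ideal P, {subset P0 <= P},
  strict_sub P Q & depth P i] >].
have ex_between : exists i, between i.
  by have [i hi] := depth_exists hP0.1; exists i; apply/asboolP; exists P0;
    split.
have bound i : between i -> (i <= j)%N.
  by move=> /asboolP[P [hP _ PQ hi]]; apply/ltnW/(depth_strict hP hQ PQ hi hj).
have [i /asboolP[P [hP P0P PQ hi]] imax] := ex_maxnP ex_between bound.
exists P, i; split=> //; apply: (depth_unique hQ hj);
  apply: (depth_adjacent hP hQ _ hi).
split=> // -[X [hX PX XQ]]; have [k hk] := depth_exists hX.1.
have := depth_strict hP hX PX hi hk; rewrite ltnNge imax //.
by apply/asboolP; exists X; split=> // a /P0P; case: PX => PX _; apply: PX.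
Qed.

(** A regular element of [Q] is not nilpotent locally at [Q]. *)
Lemma prime_below Q j : prime_ideal Q -> depth Q j -> (0 < j)%N ->
  exists2 P, prime_ideal P & strict_sub P Q.
Proof.
move=> hQ [[|q s] [<- sQ /= hs _]] // _; have [Qq _] := sub_consl sQ;
  have [hq _] := hs.
have [|P [hP _ PQ nPq]] := @prime_inside A Z Q q (zero_closed A) hQ.
  move=> k t nQt; apply/negP; rewrite mulrC => /(nzd_modX hq).
  by move=> /(sub_zero hQ.1); apply/negP.
by exists P => //; split=> //; exists q.
Qed.

Lemma depth0_below Q : prime_ideal Q ->
  exists P, [/\ prime_ideal P, {subset P <= Q} & depth P 0].
Proof.
move=> hQ; have [j] := depth_exists hQ.1.
have [n] := ubnP j; elim: n j Q hQ => // n IH [|j] Q hQ jn hj;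
  first by exists Q; split.
have [//|P hP PQ] := prime_below hQ hj.
have [i hi] := depth_exists hP.1.
have [P' [hP' P'P h0]] := IH i P hP (leq_trans (depth_strict hP hQ PQ hi hj)
  jn) hi.
by exists P'; split=> // a /P'P; case: PQ => PQ _; apply: PQ.
Qed.

(** The chain is built downwards from [Q], through adjacent primes that
    contain [P]. *)
Lemma chain_up m i P Q : prime_ideal P -> prime_ideal Q -> {subset P <= Q} ->
  depth P i -> depth Q (i + m) ->
  exists c, [/\ prime_chain m c, c 0%N = P & c m = Q].
Proof.
move=> hP; elim: m Q => [|m IH] Q hQ PQ hi hj.
  suff -> : Q = P by exists (fun=> P); split; split.
  apply: contrapT => neq; have :=
    depth_strict hP hQ (subset_strict PQ (nesym neq)) hi hj.
  by rewrite addn0 ltnn.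
have PltQ : strict_sub P Q.
  apply: subset_strict => // eqPQ; move: hj;
    rewrite -eqPQ => /(depth_unique hP hi).
  lia.
have [P' [k [hP' PP' P'Q hk ek]]] := adjacent_below hP hQ PltQ hj.
have {ek} ek : k = (i + m)%N by lia.
rewrite ek in hk; have [c [[cP cS] c0 cm]] := IH P' hP' PP' hi hk.
exists (fun l => if (l <= m)%N then c l else Q); split=> //;
  last by rewrite ltnn.
split=> l lm; first by case: ifP => [/cP //|_]; exact: hQ.
have lm' : (l <= m)%N by lia.
rewrite lm'; case: ltnP => [/cS //|ml].
have -> : l = m by lia.
by rewrite cm.
Qed.

Lemma chain_depth m c i j : prime_chain m c -> depth (c 0%N) i ->
  depth (c m) j ->
  (i + m <= j)%N.
Proof.
elim: m j => [|m IH] j [cP cS] hi hj.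
  by rewrite addn0 (depth_unique (cP 0%N isT) hi hj).
have [k hk] := depth_exists (cP m (leqnSn m)).1.
have ik : (i + m <= k)%N.
  by apply: IH => //; split=> l lm; [apply: cP | apply: cS]; lia.
have := depth_strict (cP m (leqnSn m)) (cP m.+1 (leqnn _))
  (cS m (ltnSn m)) hk hj.
by lia.
Qed.

Lemma saturated_depth m c i : saturated_chain m c -> depth (c 0%N) i ->
  depth (c m) (i + m).
Proof.
elim: m => [|m IH] [[cP cS] cM] hi; first by rewrite addn0.
rewrite addnS; apply: (depth_adjacent (cP m _) (cP m.+1 _)) => //.
  by split; [apply: cS | apply: cM].
by apply: IH => //; split; [split|] => l lm;
  [apply: cP | apply: cS | apply: cM]; lia.
Qed.

Lemma eqi_pred P Q : P =i Q -> P = Q.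
Proof. by move=> PQ; apply/funext => a; apply: PQ. Qed.

Lemma catenary_of_depth : catenary A.
Proof.
move=> P Q hP hQ PQ; have [i hi] := depth_exists hP.1;
  have [j hj] := depth_exists hQ.1.
split.
  exists j => m c [hc /eqi_pred c0 /eqi_pred cm].
  by have := @chain_depth m c i j hc; rewrite c0 cm => /(_ hi hj); lia.
have length m c : chain_between P Q m c -> saturated_chain m c -> (i + m)%N = j.
  move=> [_ /eqi_pred c0 /eqi_pred cm] sat; apply: (@depth_unique Q) => //.
  by rewrite -cm; apply: saturated_depth sat _; rewrite c0.
move=> m m' c c' hc sc hc' sc'.
by have := length _ _ hc sc; have := length _ _ hc' sc'; lia.
Qed.

Variable n : nat.
Hypothesis depthA : forall M k, maximal_ideal M -> depth M k -> k = n.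

Lemma depth_le Q j : prime_ideal Q -> depth Q j -> (j <= n)%N.
Proof.
move=> hQ hj; have [M hM QM] := maximal_above hQ.1.
have hM' := maximal_prime hM; have [k hk] := depth_exists hM'.1.
rewrite -(depthA hM hk); have [eQM|neq] := pselect (Q = M).
  by rewrite -eQM in hk; rewrite (depth_unique hQ hj hk).
exact/ltnW/(depth_strict hQ hM' (subset_strict QM neq) hj hk).
Qed.

Lemma chain_le m c : prime_chain m c -> (m <= n)%N.
Proof.
move=> hc; have [cP _] := hc.
have [i hi] := depth_exists (cP 0%N isT).1.
have [j hj] := depth_exists (cP m (leqnn _)).1.
by have := chain_depth hc hi hj; have := depth_le (cP m (leqnn _)) hj; lia.
Qed.

Lemma chain_from P : prime_ideal P -> depth P 0 ->
  exists2 c, prime_chain n c & c 0%N = P.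
Proof.
move=> hP h0; have [M hM PM] := maximal_above hP.1;
  have hM' := maximal_prime hM.
have [k hk] := depth_exists hM'.1; have ek := depthA hM hk; rewrite ek in hk.
by have [c [hc c0 _]] := chain_up hP hM' PM h0 hk; exists c.
Qed.

Lemma krull_dim_of_depth : has_krull_dim A (Some n).
Proof.
split; last exact: chain_le.
have [M hM _] := maximal_above (zero_closed A).
have [P [hP _ h0]] := depth0_below (maximal_prime hM).
by have [c hc _] := chain_from hP h0; exists c.
Qed.

Lemma minimal_depth0 P : minimal_prime P -> depth P 0.
Proof.
move=> [hP Pmin]; have [[|j] hj] := depth_exists hP.1 => //.
have [//|X hX [XP [a Pa nXa]]] := prime_below hP hj.
by move: nXa; rewrite (Pmin X hX XP a Pa).
Qed.

End Depth.

(** * Primes of a quotient ring *)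

Section QuotientPrimes.
Variables (A : comNzRingType) (P : A -> bool) (hP : idealr_closed P).
Local Notation B := (quot_ring hP).

Definition quot_proj (a : A) : B := \pi_{ideal_quot (ideal_of hP)} a.

Lemma quot_projP a b : quot_proj a = quot_proj b <-> a - b \in P.
Proof.
rewrite -[a - b \in P]/(a - b \in ideal_of hP) Quotient.idealrBE.
by split=> [/eqP|/eqP].
Qed.

Lemma quot_projD : {morph quot_proj : a b / a + b}.
Proof. by move=> a b; rewrite /quot_proj -rmorphD. Qed.

Lemma quot_projM : {morph quot_proj : a b / a * b}.
Proof. by move=> a b; rewrite /quot_proj -rmorphM. Qed.

Lemma quot_proj1 : quot_proj 1 = 1.
Proof. by rewrite /quot_proj rmorph1. Qed.

Lemma quot_proj0 : quot_proj 0 = 0.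
Proof. by rewrite /quot_proj rmorph0. Qed.

Lemma quot_projW (S : B -> Prop) : (forall a, S (quot_proj a)) -> forall b, S b.
Proof. by move=> h; elim/quotW => a; apply: h. Qed.

Definition preim_pred (X : B -> bool) : A -> bool := fun a => X (quot_proj a).
Definition image_pred (X : A -> bool) : B -> bool :=
  fun b => `[< exists2 a, b = quot_proj a & a \in X >].

Lemma mem_preim X a : (a \in preim_pred X) = (quot_proj a \in X).
Proof. by []. Qed.

Lemma mem_image X a : idealr_closed X -> {subset P <= X} ->
  (quot_proj a \in image_pred X) = (a \in X).
Proof.
move=> hX PX; apply/asboolP/idP => [[b /quot_projP/PX ab bX]|aX];
  last by exists a.
exact: ideal_subr hX ab bX.
Qed.

Lemma preim_prime X : prime_ideal X -> prime_ideal (preim_pred X).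
Proof.
move=> [[X0 X1 hX] XM]; split; first split.
- by rewrite mem_preim quot_proj0.
- by rewrite mem_preim quot_proj1.
- by move=> a u v; rewrite !mem_preim quot_projD quot_projM; apply: hX.
by move=> u v; rewrite !mem_preim quot_projM; apply: XM.
Qed.

Lemma preim_strict X Y : strict_sub X Y ->
  strict_sub (preim_pred X) (preim_pred Y).
Proof.
move=> [XY [b Yb nXb]]; split=> [a|]; first by rewrite !mem_preim; apply: XY.
elim/quot_projW: b Yb nXb => a Ya nXa.
by exists a.
Qed.

Lemma image_prime X : prime_ideal X -> {subset P <= X} ->
  prime_ideal (image_pred X).
Proof.
move=> [hX XM] PX; have E := mem_image _ hX PX; split; first split.
- by rewrite -quot_proj0 E ideal0.
- by rewrite -quot_proj1 E ideal1.
- elim/quot_projW => a; elim/quot_projW => u; elim/quot_projW => v.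
  by rewrite -quot_projM -quot_projD !E; case: hX => _ _; apply.
elim/quot_projW => u; elim/quot_projW => v.
by rewrite -quot_projM !E; apply: XM.
Qed.

Lemma image_strict X Y : idealr_closed X -> idealr_closed Y ->
  {subset P <= X} ->
  strict_sub X Y -> strict_sub (image_pred X) (image_pred Y).
Proof.
move=> hX hY PX [XY [a Ya nXa]].
have PY : {subset P <= Y} by move=> b /PX/XY.
split; last by exists (quot_proj a); rewrite mem_image.
by elim/quot_projW => b; rewrite !mem_image //; apply: XY.
Qed.

Lemma preim_chain m c : prime_chain m c ->
  prime_chain m (fun i => preim_pred (c i)).
Proof.
by move=> [cP cS]; split=> i im; [apply/preim_prime/cP | apply/preim_strict/cS].
Qed.

Lemma image_chain m c : prime_chain m c -> {subset P <= c 0%N} ->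
  prime_chain m (fun i => image_pred (c i)).
Proof.
move=> [cP cS] P0.
have Pc i : (i <= m)%N -> {subset P <= c i}.
  elim: i => [|i IH] im //= a /(IH (ltnW im)); case: (cS i im) => + _; apply.
split=> i im; first by apply: image_prime; [apply: cP | apply: Pc].
apply: image_strict (cS i im); first exact: (cP i (ltnW im)).1.
  exact: (cP i.+1 im).1.
exact: Pc (ltnW im).
Qed.

End QuotientPrimes.

Theorem corollary3p5 (n : nat) (A : comNzRingType) (hA : n_subperfect n A) :
  [/\ catenary A, equidimensional A & has_krull_dim A (Some n)].
Proof.
have [subA lenA finA] := hA.
have regP (Q : A -> bool) (s : seq A) : idealr_closed Q ->
  {subset s <= Q} -> reg_mod (@zero_ideal A) s ->
    regular_seq s.
  move=> hQ sQ hs; apply/regular_seqP; split=> //.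
  by apply/negP => /(span_zero_sub hQ sQ).2; apply/negP/ideal1.
have dccA (Q : A -> bool) : idealr_closed Q -> regularly_dcc Q (@zero_ideal A).
  move=> hQ s sQ hs; rewrite -gen_ideal_span.
  exact: quot_dcc (subA s (regP Q s hQ sQ hs)).
have depthA (M : A -> bool) k : maximal_ideal M -> depth M k -> k = n.
  move=> hM [s [<- sM hs degs]]; apply: lenA; split;
    first exact: regP hM.1 sM hs.
  exists M; split=> // x Mx /regular_seqP[_ /reg_mod_rcons[_ hx]].
  exact: degs x Mx hx.
split; [exact: catenary_of_depth | | exact: krull_dim_of_depth].
exists (Some n) => P minP; split=> [|m c hc].
  have [c hc c0] := chain_from dccA finA depthA minP.1 (minimal_depth0 finA
    minP).
  by eexists; apply: image_chain hc _; rewrite c0.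
exact: (chain_le dccA finA depthA (preim_chain hc)).
Qed.
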